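(* A $C^*$ (respectively $W^*$) 2-category $\mathcal C$ is Q-system complete if and only if every Q-system in $\mathcal C$ splits, i.e., for every object $b\in\mathcal C$ and every Q-system $(Q,m,i)$ with $Q\in\mathcal C(b\to b)$, there is an object $c\in\mathcal C$ and a dualizable 1-morphism ${}_bX_c\in\mathcal C(b\to c)$ which admits a unitarily separable dual $(X^\vee,\mathrm{ev}_X,\mathrm{coev}_X)$ such that $(Q,m,i)$ is isomorphic, as a Q-system, to $X\boxtimes_cX^\vee$ with multiplication $\mathrm{id}_X\boxtimes\mathrm{ev}_X\boxtimes\mathrm{id}_{X^\vee}$ and unit $\mathrm{coev}_X$.
   Context: **$C^*$/$W^*$ 2-categories.** A 2-category means a bicategory with 2-morphism spaces complex vector spaces and bilinear compositions. 1-composition is written left to right: $X\boxtimes_bY:a\to c$ for $X:a\to b$, $Y:b\to c$; 2-composition $\circ$ right to left. A dagger structure consists of anti-linear maps $\dagger:\mathcal C(X\Rightarrow Y)\to\mathcal C(Y\Rightarrow X)$ with $f^{\dagger\dagger}=f$, $(g\circ f)^\dagger=f^\dagger\circ g^\dagger$, $(f\boxtimes g)^\dagger=f^\dagger\boxtimes g^\dagger$, and all unitors and associators unitary ($u^\dagger=u^{-1}$). A $C^*$ 2-category is a $\dagger$ 2-category such that for every $f:X\Rightarrow Y$ there is $g:X\Rightarrow X$ with $f^\dagger f=g^\dagger g$, and $\|f\|^2:=\sup\{|\lambda|\ge0: f^\dagger f-\lambda\,\mathrm{id}_X\text{ is not invertible}\}$ defines a complete norm on each $\mathcal C(X\Rightarrow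 Y)$ which is submultiplicative and satisfies $\|f^\dagger f\|=\|f\|^2$. A $W^*$ 2-category is a $C^*$ 2-category in which each Banach space $\mathcal C(X\Rightarrow Y)$ has a predual and 1-composition $\boxtimes$ is weak*-continuous in each variable separately. Standing assumption: all hom categories are unitarily Cauchy complete, i.e., admit orthogonal direct sums (isometries $v_j:X_j\Rightarrow\bigoplus X_i$ with $\sum_jv_jv_j^\dagger=\mathrm{id}$), and every orthogonal projection $p$ splits as $p=vv^\dagger$ with $v$ an isometry. Associators and unitors are suppressed. **Q-systems and $\mathsf{QSys}(\mathcal C)$.** A Q-system is $Q\in\mathcal C(b\to b)$ with $m:Q\boxtimes Q\Rightarrow Q$, $i:1_b\Rightarrow Q$ satisfying: $m(m\boxtimes\mathrm{id})=m(\mathrm{id}\boxtimes m)$; $m(i\boxtimes\mathrm{id})=\mathrm{id}_Q=m(\mathrm{id}\boxtimes i)$; $(\mathrm{id}\boxtimes m)(m^\dagger\boxtimes\mathrm{id})=m^\dagger m=(m\boxtimes\mathrm{id})(\mathrm{id}\boxtimes m^\dagger)$; $mm^\dagger=\mathrm{id}_Q$. An isomorphism of Q-systems over the same $b$ is a unitary 2-morphism intertwining multiplications and units. For Q-systems $P:a\to a$, $Q:b\to b$, a $P$-$Q$ bimodule is $X:a\to b$ with $\lambda:P\boxtimes X\Rightarrow X$, $\rho:X\boxtimes Q\Rightarrow X$ that are associative ($\lambda(\mathrm{id}_P\boxtimes\lambda)=\lambda(m_P\boxtimes\mathrm{id}_X)$, $\rho(\rho\boxtimes\mathrm{id}_Q)=\rho(\mathrm{id}_X\boxtimes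 m_Q)$, $\rho(\lambda\boxtimes\mathrm{id}_Q)=\lambda(\mathrm{id}_P\boxtimes\rho)$), unital ($\lambda(i_P\boxtimes\mathrm{id}_X)=\mathrm{id}_X=\rho(\mathrm{id}_X\boxtimes i_Q)$), Frobenius ($(m_P\boxtimes\mathrm{id}_X)(\mathrm{id}_P\boxtimes\lambda^\dagger)=\lambda^\dagger\lambda=(\mathrm{id}_P\boxtimes\lambda)(m_P^\dagger\boxtimes\mathrm{id}_X)$ and $(\mathrm{id}_X\boxtimes m_Q)(\rho^\dagger\boxtimes\mathrm{id}_Q)=\rho^\dagger\rho=(\rho\boxtimes\mathrm{id}_Q)(\mathrm{id}_X\boxtimes m_Q^\dagger)$), and separable ($\lambda\lambda^\dagger=\mathrm{id}_X=\rho\rho^\dagger$). $\mathsf{QSys}(\mathcal C)$ has objects the Q-systems, 1-morphisms $P\to Q$ the $P$-$Q$ bimodules, 2-morphisms the $f:X\Rightarrow Y$ with $f\lambda_X=\lambda_Y(\mathrm{id}_P\boxtimes f)$, $f\rho_X=\rho_Y(f\boxtimes\mathrm{id}_Q)$. The composite of ${}_PX_Q$, ${}_QY_R$ is $X\otimes_QY$, defined by a $P$-$R$ bimodular coisometry $u_{X,Y}:X\boxtimes Y\Rightarrow X\otimes_QY$ with $u_{X,Y}^\dagger u_{X,Y}=(\mathrm{id}_X\boxtimes\lambda_Y)(\rho_X^\dagger\boxtimes\mathrm{id}_Y)$; horizontal composition is $f\otimes_Qg=u(f\boxtimes g)u^\dagger$; the identity of $Q$ is $Q$; unitors are $\lambda_Yu_{Q,Y}^\dagger$,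 $\rho_Xu_{X,Q}^\dagger$; the associator is $u(\mathrm{id}\boxtimes u)\alpha^{\mathcal C}(u^\dagger\boxtimes\mathrm{id})u^\dagger$. **Q-system completeness.** The inclusion $\iota_{\mathcal C}:\mathcal C\to\mathsf{QSys}(\mathcal C)$ sends $c$ to the trivial Q-system $1_c$, ${}_aX_b$ to $X$ as a $1_a$-$1_b$ bimodule, and each 2-morphism to itself. $\mathcal C$ is Q-system complete if $\iota_{\mathcal C}$ is a $\dagger$ 2-equivalence (equivalently: essentially surjective on objects up to equivalence, unitarily essentially surjective on 1-morphisms, and fully faithful on 2-morphisms). **Duals.** A dual of ${}_bX_c$ is $({}_cX^\vee_b,\mathrm{ev}_X,\mathrm{coev}_X)$ with $\mathrm{ev}_X:X^\vee\boxtimes_bX\Rightarrow1_c$ and $\mathrm{coev}_X:1_b\Rightarrow X\boxtimes_cX^\vee$ satisfying the zig-zag equations $(\mathrm{id}_X\boxtimes\mathrm{ev}_X)(\mathrm{coev}_X\boxtimes\mathrm{id}_X)=\mathrm{id}_X$, $(\mathrm{ev}_X\boxtimes\mathrm{id}_{X^\vee})(\mathrm{id}_{X^\vee}\boxtimes\mathrm{coev}_X)=\mathrm{id}_{X^\vee}$. It is unitarily separable if $\mathrm{ev}_X\circ\mathrm{ev}_X^\dagger=\mathrm{id}_{1_c}$; in that case $X\boxtimes_cX^\vee$ with the multiplication and unit in the claim is a Q-system. *)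

(* Defs.v *)
From HB Require Import structures.
From mathcomp Require Import all_boot all_order all_algebra complex.
From mathcomp Require Import boolp classical_sets reals topology normedtype.
From mathcomp Require Import function_spaces.

Set Implicit Arguments.
Unset Strict Implicit.
Unset Printing Implicit Defensive.

Import Order.TTheory GRing.Theory Num.Theory numFieldNormedType.Exports.
Local Open Scope classical_set_scope.
Local Open Scope ring_scope.

Declare Scope twocat_scope.
Delimit Scope twocat_scope with two.
Local Open Scope twocat_scope.

Reserved Notation "X ⊠ Y" (at level 40, left associativity).
Reserved Notation "f ⊡ g" (at level 40, left associativity).
Reserved Notation "X ◁ f" (at level 40, left associativity).
Reserved Notation "f ▷ Y" (at level 40, left associativity).
Reserved Notation "g ∘ f" (at level 50, left associativity).
Reserved Notation "f ^†" (at level 3, left associativity, format "f ^†").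

(* A dagger 2-category: a C-linear bicategory with a dagger structure.        *)
(*   mor a b    1-morphisms a -> b                                            *)
(*   cell X Y   2-morphisms X => Y                                            *)
(*   X ⊠ Y      1-composition, written left to right                          *)
(*   f ⊡ g      1-composition of 2-morphisms                                  *)
(*   g ∘ f      2-composition, written right to left                          *)
(* Invertibility of the associators and unitors is part of their unitarity.   *)
Record dag2cat (R : realType) := Dag2Cat {
  obj : Type;
  mor : obj -> obj -> Type;
  cell : forall a b : obj, mor a b -> mor a b -> lmodType R[i];
  unit1 : forall a : obj, mor a a;
  tens : forall a b c : obj, mor a b -> mor b c -> mor a c
    where "X ⊠ Y" := (tens X Y);
  id2 : forall (a b : obj) (X : mor a b), cell X X;
  vcomp : forall (a b : obj) (X Y Z : mor a b),
    cell Y Z -> cell X Y -> cell X Z where "g ∘ f" := (vcomp g f);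
  hcomp : forall (a b c : obj) (X X' : mor a b) (Y Y' : mor b c),
    cell X X' -> cell Y Y' -> cell (X ⊠ Y) (X' ⊠ Y')
    where "f ⊡ g" := (hcomp f g);
  dag : forall (a b : obj) (X Y : mor a b), cell X Y -> cell Y X
    where "f ^†" := (dag f);
  assoc : forall (a b c d : obj) (X : mor a b) (Y : mor b c) (Z : mor c d),
    cell ((X ⊠ Y) ⊠ Z) (X ⊠ (Y ⊠ Z));
  lunit : forall (a b : obj) (X : mor a b), cell (unit1 a ⊠ X) X;
  runit : forall (a b : obj) (X : mor a b), cell (X ⊠ unit1 b) X;

  vcompA : forall (a b : obj) (W X Y Z : mor a b)
    (h : cell Y Z) (g : cell X Y) (f : cell W X), h ∘ (g ∘ f) = h ∘ g ∘ f;
  vcomp1l : forall (a b : obj) (X Y : mor a b) (f : cell X Y),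
    id2 Y ∘ f = f;
  vcomp1r : forall (a b : obj) (X Y : mor a b) (f : cell X Y),
    f ∘ id2 X = f;
  hcomp1 : forall (a b c : obj) (X : mor a b) (Y : mor b c),
    id2 X ⊡ id2 Y = id2 (X ⊠ Y);
  interchange : forall (a b c : obj) (X1 X2 X3 : mor a b) (Y1 Y2 Y3 : mor b c)
    (f : cell X1 X2) (f' : cell X2 X3) (g : cell Y1 Y2) (g' : cell Y2 Y3),
    (f' ⊡ g') ∘ (f ⊡ g) = (f' ∘ f) ⊡ (g' ∘ g);

  vcomp_linear_l : forall (a b : obj) (X Y Z : mor a b) (f : cell X Y),
    linear (fun g : cell Y Z => g ∘ f);
  vcomp_linear_r : forall (a b : obj) (X Y Z : mor a b) (g : cell Y Z),
    linear (fun f : cell X Y => g ∘ f);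
  hcomp_linear_l : forall (a b c : obj) (X X' : mor a b) (Y Y' : mor b c)
    (g : cell Y Y'), linear (fun f : cell X X' => f ⊡ g);
  hcomp_linear_r : forall (a b c : obj) (X X' : mor a b) (Y Y' : mor b c)
    (f : cell X X'), linear (fun g : cell Y Y' => f ⊡ g);

  assoc_nat : forall (a b c d : obj) (X X' : mor a b) (Y Y' : mor b c)
    (Z Z' : mor c d) (f : cell X X') (g : cell Y Y') (h : cell Z Z'),
    assoc X' Y' Z' ∘ ((f ⊡ g) ⊡ h) = (f ⊡ (g ⊡ h)) ∘ assoc X Y Z;
  lunit_nat : forall (a b : obj) (X Y : mor a b) (f : cell X Y),
    lunit Y ∘ (id2 (unit1 a) ⊡ f) = f ∘ lunit X;
  runit_nat : forall (a b : obj) (X Y : mor a b) (f : cell X Y),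
    runit Y ∘ (f ⊡ id2 (unit1 b)) = f ∘ runit X;
  pentagon : forall (a b c d e : obj)
    (W : mor a b) (X : mor b c) (Y : mor c d) (Z : mor d e),
    (id2 W ⊡ assoc X Y Z) ∘ assoc W (X ⊠ Y) Z ∘ (assoc W X Y ⊡ id2 Z) =
    assoc W X (Y ⊠ Z) ∘ assoc (W ⊠ X) Y Z;
  triangle : forall (a b c : obj) (X : mor a b) (Y : mor b c),
    (id2 X ⊡ lunit Y) ∘ assoc X (unit1 b) Y = runit X ⊡ id2 Y;

  dag_antilinear : forall (a b : obj) (X Y : mor a b) (k : R[i])
    (f g : cell X Y), (k *: f + g)^† = k^* *: f^† + g^†;
  dagK : forall (a b : obj) (X Y : mor a b) (f : cell X Y), f^†^† = f;
  dag_vcomp : forall (a b : obj) (X Y Z : mor a b)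
    (g : cell Y Z) (f : cell X Y), (g ∘ f)^† = f^† ∘ g^†;
  dag_hcomp : forall (a b c : obj) (X X' : mor a b) (Y Y' : mor b c)
    (f : cell X X') (g : cell Y Y'), (f ⊡ g)^† = f^† ⊡ g^†;
  assocVl : forall (a b c d : obj) (X : mor a b) (Y : mor b c) (Z : mor c d),
    (assoc X Y Z)^† ∘ assoc X Y Z = id2 ((X ⊠ Y) ⊠ Z);
  assocVr : forall (a b c d : obj) (X : mor a b) (Y : mor b c) (Z : mor c d),
    assoc X Y Z ∘ (assoc X Y Z)^† = id2 (X ⊠ (Y ⊠ Z));
  lunitVl : forall (a b : obj) (X : mor a b),
    (lunit X)^† ∘ lunit X = id2 (unit1 a ⊠ X);
  lunitVr : forall (a b : obj) (X : mor a b),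
    lunit X ∘ (lunit X)^† = id2 X;
  runitVl : forall (a b : obj) (X : mor a b),
    (runit X)^† ∘ runit X = id2 (X ⊠ unit1 b);
  runitVr : forall (a b : obj) (X : mor a b),
    runit X ∘ (runit X)^† = id2 X
}.

Arguments mor {R} _ _ _.
Arguments cell {R} _ {a b} _ _.
Arguments unit1 {R C} _ : rename.
Arguments tens {R C a b c} _ _ : rename.
Arguments id2 {R C a b} _ : rename.
Arguments vcomp {R C a b X Y Z} _ _ : rename.
Arguments hcomp {R C a b c X X' Y Y'} _ _ : rename.
Arguments dag {R C a b X Y} _ : rename.
Arguments assoc {R C a b c d} _ _ _ : rename.
Arguments lunit {R C a b} _ : rename.
Arguments runit {R C a b} _ : rename.

Notation "X ⊠ Y" := (tens X Y) : twocat_scope.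
Notation "f ⊡ g" := (hcomp f g) : twocat_scope.
Notation "X ◁ f" := (hcomp (id2 X) f) : twocat_scope.
Notation "f ▷ Y" := (hcomp f (id2 Y)) : twocat_scope.
Notation "g ∘ f" := (vcomp g f) : twocat_scope.
Notation "f ^†" := (dag f) : twocat_scope.

Section CauchyComplete.
Variables (R : realType) (C : dag2cat R).

Definition invertible (a b : obj C) (X Y : mor C a b) (f : cell C X Y) :=
  exists g : cell C Y X, g ∘ f = id2 X /\ f ∘ g = id2 Y.

Definition is_isometry (a b : obj C) (X Y : mor C a b) (v : cell C X Y) :=
  v^† ∘ v = id2 X.

Definition is_unitary (a b : obj C) (X Y : mor C a b) (u : cell C X Y) :=
  u^† ∘ u = id2 X /\ u ∘ u^† = id2 Y.

Definition is_projection (a b : obj C) (X : mor C a b) (p : cell C X X) :=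
  p ∘ p = p /\ p^† = p.

(* Finite families may be empty, so every hom category has a zero object. *)
Record cauchy_complete : Prop := CauchyComplete {
  orthogonal_sums : forall (a b : obj C) (n : nat) (X : 'I_n -> mor C a b),
    exists (S : mor C a b) (v : forall j, cell C (X j) S),
      (forall j, is_isometry (v j)) /\ \sum_j (v j ∘ (v j)^†) = id2 S;
  projections_split : forall (a b : obj C) (X : mor C a b) (p : cell C X X),
    is_projection p ->
    exists (W : mor C a b) (v : cell C W X), is_isometry v /\ p = v ∘ v^†
}.

End CauchyComplete.

Section CStar.
Variables (R : realType) (C : dag2cat R).

Definition spec_radii (a b : obj C) (X Y : mor C a b) (f : cell C X Y) :
    set R :=
  [set Normc.normc l | l in
    [set l : R[i] | ~ invertible (f^† ∘ f - l *: id2 X)]].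

(* The set of radii is empty only if X is a zero object; the supremum is then *)
(* 0, which is the value sup gives it.                                        *)
Definition cnorm (a b : obj C) (X Y : mor C a b) (f : cell C X Y) : R :=
  Num.sqrt (sup (spec_radii f)).

Record is_cstar : Prop := IsCStar {
  cstar_pos : forall (a b : obj C) (X Y : mor C a b) (f : cell C X Y),
    exists g : cell C X X, f^† ∘ f = g^† ∘ g;
  cnorm_finite : forall (a b : obj C) (X Y : mor C a b) (f : cell C X Y),
    has_ubound (spec_radii f);
  cnorm_eq0 : forall (a b : obj C) (X Y : mor C a b) (f : cell C X Y),
    cnorm f = 0 -> f = 0;
  cnormZ : forall (a b : obj C) (X Y : mor C a b) (k : R[i]) (f : cell C X Y),
    cnorm (k *: f) = Normc.normc k * cnorm f;
  cnormD : forall (a b : obj C) (X Y : mor C a b) (f g : cell C X Y),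
    cnorm (f + g) <= cnorm f + cnorm g;
  cnorm_complete : forall (a b : obj C) (X Y : mor C a b)
    (f : nat -> cell C X Y),
    (forall e : R, 0 < e -> exists N, forall m n, (N <= m)%N -> (N <= n)%N ->
      cnorm (f m - f n) < e) ->
    exists g : cell C X Y, forall e : R, 0 < e -> exists N, forall n,
      (N <= n)%N -> cnorm (f n - g) < e;
  cnormM : forall (a b : obj C) (X Y Z : mor C a b)
    (g : cell C Y Z) (f : cell C X Y), cnorm (g ∘ f) <= cnorm g * cnorm f;
  cnorm_cstar : forall (a b : obj C) (X Y : mor C a b) (f : cell C X Y),
    cnorm (f^† ∘ f) = cnorm f ^+ 2
}.

End CStar.

(* An isometric isomorphism of (H, nrm) with the dual of a Banach space.      *)
Record predual (R : realType) (H : lmodType R[i]) (nrm : H -> R) := Predual {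
  presp : completeNormedModType R[i];
  pairing : H -> presp -> R[i]^o;
  pairing_linear_l : forall e : presp, linear (pairing ^~ e);
  pairing_linear_r : forall f : H, linear (pairing f);
  pairing_continuous : forall f : H, continuous (pairing f);
  pairing_norm : forall f : H,
    nrm f = sup [set Normc.normc (pairing f e) | e in [set e | `|e| <= 1]];
  pairing_onto : forall phi : presp -> R[i]^o,
    linear phi -> continuous phi -> exists f : H, pairing f = phi
}.

Arguments pairing {R H nrm} _ _ _ : rename.

(* H with the weak* topology: pointwise convergence on the predual. *)
Definition weakstar (R : realType) (H : lmodType R[i]) (nrm : H -> R)
    (E : predual nrm) : topologicalType :=
  initial_topology (pairing E : H -> {ptws presp E -> R[i]^o}).

Definition is_wstar (R : realType) (C : dag2cat R) : Prop :=
  is_cstar C /\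
  exists E : forall (a b : obj C) (X Y : mor C a b),
      predual (@cnorm R C a b X Y),
    (forall (a b c : obj C) (X X' : mor C a b) (Y Y' : mor C b c)
      (g : cell C Y Y'),
      continuous ((fun f => f ⊡ g) : weakstar (E a b X X') ->
        weakstar (E a c (X ⊠ Y) (X' ⊠ Y')))) /\
    (forall (a b c : obj C) (X X' : mor C a b) (Y Y' : mor C b c)
      (f : cell C X X'),
      continuous ((fun g => f ⊡ g) : weakstar (E b c Y Y') ->
        weakstar (E a c (X ⊠ Y) (X' ⊠ Y')))).

Section Basic.
Variables (R : realType) (C : dag2cat R).

Lemma vc (a b : obj C) (U X Y Z : mor C a b) (g : cell C Y Z) (f : cell C X Y)
  (h : cell C X Z) (E : g ∘ f = h) (k : cell C U X) : g ∘ (f ∘ k) = h ∘ k.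
Proof. by rewrite vcompA E. Qed.

Lemma vc1 (a b : obj C) (X Y Z : mor C a b) (g : cell C Y X) (f : cell C X Y)
  (E : g ∘ f = id2 X) (k : cell C Z X) : g ∘ (f ∘ k) = k.
Proof. by rewrite vcompA E vcomp1l. Qed.

Lemma dag1 (a b : obj C) (X : mor C a b) : (id2 X)^† = id2 X.
Proof. by rewrite -[LHS]vcomp1l -{1}(dagK (id2 X)) -dag_vcomp vcomp1l dagK. Qed.

Lemma dag_inj (a b : obj C) (X Y : mor C a b) (f g : cell C X Y) :
  f^† = g^† -> f = g.
Proof. by move=> E; rewrite -(dagK f) E dagK. Qed.

Lemma rcancel (a b : obj C) (X Y Z : mor C a b) (u : cell C X Y)
  (f g : cell C Y Z) : u ∘ u^† = id2 Y -> f ∘ u = g ∘ u -> f = g.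
Proof. by move=> hu E; rewrite -(vcomp1r f) -hu vcompA E -vcompA hu vcomp1r. Qed.

Lemma lcancel (a b : obj C) (X Y Z : mor C a b) (u : cell C X Y)
  (f g : cell C Z X) : u^† ∘ u = id2 X -> u ∘ f = u ∘ g -> f = g.
Proof. by move=> hu E; rewrite -(vcomp1l f) -hu -vcompA E vcompA hu vcomp1l. Qed.

Lemma lwM (a b c : obj C) (X : mor C a b) (Y Y' Y'' : mor C b c)
  (g : cell C Y' Y'') (f : cell C Y Y') : (X ◁ g) ∘ (X ◁ f) = X ◁ (g ∘ f).
Proof. by rewrite interchange vcomp1l. Qed.

Lemma rwM (a b c : obj C) (X X' X'' : mor C a b) (Y : mor C b c)
  (g : cell C X' X'') (f : cell C X X') : (g ▷ Y) ∘ (f ▷ Y) = (g ∘ f) ▷ Y.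
Proof. by rewrite interchange vcomp1l. Qed.

Lemma slide (a b c : obj C) (X X' : mor C a b) (Y Y' : mor C b c)
  (f : cell C X X') (g : cell C Y Y') : (f ▷ Y') ∘ (X ◁ g) = f ⊡ g.
Proof. by rewrite interchange vcomp1l vcomp1r. Qed.

Lemma slide' (a b c : obj C) (X X' : mor C a b) (Y Y' : mor C b c)
  (f : cell C X X') (g : cell C Y Y') : (X' ◁ g) ∘ (f ▷ Y) = f ⊡ g.
Proof. by rewrite interchange vcomp1l vcomp1r. Qed.

Lemma anL (a b c d : obj C) (X X' : mor C a b) (Y : mor C b c) (Z : mor C c d)
  (f : cell C X X') :
  assoc X' Y Z ∘ ((f ▷ Y) ▷ Z) = (f ▷ (Y ⊠ Z)) ∘ assoc X Y Z.
Proof. by rewrite assoc_nat hcomp1. Qed.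

Lemma anM (a b c d : obj C) (X : mor C a b) (Y Y' : mor C b c) (Z : mor C c d)
  (f : cell C Y Y') :
  assoc X Y' Z ∘ ((X ◁ f) ▷ Z) = (X ◁ (f ▷ Z)) ∘ assoc X Y Z.
Proof. exact: assoc_nat. Qed.

Lemma anR (a b c d : obj C) (X : mor C a b) (Y : mor C b c) (Z Z' : mor C c d)
  (f : cell C Z Z') :
  assoc X Y Z' ∘ ((X ⊠ Y) ◁ f) = (X ◁ (Y ◁ f)) ∘ assoc X Y Z.
Proof. by rewrite -assoc_nat hcomp1. Qed.

Lemma dan (a b c d : obj C) (X X' : mor C a b) (Y Y' : mor C b c)
    (Z Z' : mor C c d) (f : cell C X X') (g : cell C Y Y') (h : cell C Z Z') :
    (assoc X' Y' Z')^† ∘ (f ⊡ (g ⊡ h)) = ((f ⊡ g) ⊡ h) ∘ (assoc X Y Z)^†.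
Proof.
by apply: dag_inj; rewrite !dag_vcomp !dag_hcomp !dagK assoc_nat.
Qed.

Lemma danL (a b c d : obj C) (X X' : mor C a b) (Y : mor C b c) (Z : mor C c d)
  (f : cell C X X') :
  (assoc X' Y Z)^† ∘ (f ▷ (Y ⊠ Z)) = ((f ▷ Y) ▷ Z) ∘ (assoc X Y Z)^†.
Proof. by rewrite -hcomp1 dan. Qed.

Lemma danM (a b c d : obj C) (X : mor C a b) (Y Y' : mor C b c) (Z : mor C c d)
  (f : cell C Y Y') :
  (assoc X Y' Z)^† ∘ (X ◁ (f ▷ Z)) = ((X ◁ f) ▷ Z) ∘ (assoc X Y Z)^†.
Proof. exact: dan. Qed.

Lemma danR (a b c d : obj C) (X : mor C a b) (Y : mor C b c) (Z Z' : mor C c d)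
  (f : cell C Z Z') :
  (assoc X Y Z')^† ∘ (X ◁ (Y ◁ f)) = ((X ⊠ Y) ◁ f) ∘ (assoc X Y Z)^†.
Proof. by rewrite dan hcomp1. Qed.

Lemma lwV (a b c : obj C) (X : mor C a b) (Y Y' : mor C b c)
  (f : cell C Y Y') (g : cell C Y' Y) :
  f ∘ g = id2 Y' -> (X ◁ f) ∘ (X ◁ g) = id2 (X ⊠ Y').
Proof. by move=> E; rewrite lwM E hcomp1. Qed.

Lemma rwV (a b c : obj C) (X X' : mor C a b) (Y : mor C b c)
  (f : cell C X X') (g : cell C X' X) :
  f ∘ g = id2 X' -> (f ▷ Y) ∘ (g ▷ Y) = id2 (X' ⊠ Y).
Proof. by move=> E; rewrite rwM E hcomp1. Qed.

Section Pentagon.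
Variables (a b c d e : obj C).
Variables (W : mor C a b) (X : mor C b c) (Y : mor C c d) (Z : mor C d e).

Lemma pent2 : (W ◁ assoc X Y Z) ∘ assoc W (X ⊠ Y) Z =
  assoc W X (Y ⊠ Z) ∘ assoc (W ⊠ X) Y Z ∘ ((assoc W X Y)^† ▷ Z).
Proof. by rewrite -pentagon -!vcompA (rwV _ (assocVr _ _ _)) vcomp1r. Qed.

Lemma pent3 : (assoc W X (Y ⊠ Z))^† ∘ (W ◁ assoc X Y Z) ∘ assoc W (X ⊠ Y) Z =
  assoc (W ⊠ X) Y Z ∘ ((assoc W X Y)^† ▷ Z).
Proof. by rewrite -vcompA pent2 -!vcompA (vc1 (assocVl _ _ _)). Qed.

Lemma pent4 : (assoc W X (Y ⊠ Z))^† ∘ (W ◁ assoc X Y Z) =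
  assoc (W ⊠ X) Y Z ∘ ((assoc W X Y)^† ▷ Z) ∘ (assoc W (X ⊠ Y) Z)^†.
Proof. by rewrite -pent3 -!vcompA assocVr vcomp1r. Qed.

Lemma pent5 : (assoc W (X ⊠ Y) Z)^† ∘ (W ◁ (assoc X Y Z)^†) ∘
  assoc W X (Y ⊠ Z) = (assoc W X Y ▷ Z) ∘ (assoc (W ⊠ X) Y Z)^†.
Proof.
have /(congr1 dag) := pent4; rewrite !dag_vcomp !dag_hcomp !dagK !dag1 -!vcompA.
by move=> ->; rewrite (vc1 (assocVl _ _ _)).
Qed.
End Pentagon.

Lemma unit_faithl (a b : obj C) (X Y : mor C a b) (f g : cell C X Y) :
  unit1 a ◁ f = unit1 a ◁ g -> f = g.
Proof.
move=> E; apply: (@rcancel _ _ _ _ _ (lunit X)); first exact: lunitVr.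
by rewrite -!lunit_nat E.
Qed.

Lemma unit_faithr (a b : obj C) (X Y : mor C a b) (f g : cell C X Y) :
  f ▷ unit1 b = g ▷ unit1 b -> f = g.
Proof.
move=> E; apply: (@rcancel _ _ _ _ _ (runit X)); first exact: runitVr.
by rewrite -!runit_nat E.
Qed.

Lemma kelly_l (a b c : obj C) (X : mor C a b) (Y : mor C b c) :
  lunit (X ⊠ Y) ∘ assoc (unit1 a) X Y = lunit X ▷ Y.
Proof.
apply: unit_faithl.
apply: (@rcancel _ _ _ _ _ (assoc _ (unit1 a ⊠ X) Y)); first exact: assocVr.
apply: (@rcancel _ _ _ _ _ (assoc (unit1 a) _ X ▷ Y)).
  by rewrite dag_hcomp dag1 (rwV _ (assocVr _ _ _)).
rewrite -lwM -2!vcompA (vcompA (_ ◁ assoc _ _ _)) pentagon vcompA triangle.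
rewrite -hcomp1 -assoc_nat -triangle -rwM vcompA.
by rewrite assoc_nat.
Qed.

Lemma lunit_runit (a : obj C) : lunit (unit1 a) = runit (unit1 a).
Proof.
apply: unit_faithr; rewrite -triangle -kelly_l; congr (_ ∘ _).
apply: (@lcancel _ _ _ _ _ (lunit (unit1 a))); first exact: lunitVl.
by rewrite lunit_nat.
Qed.

End Basic.

(* Reversal of 1-morphisms; it exchanges left and right modules. *)
Section Opposite.
Variables (R : realType) (C : dag2cat R).

Definition op : dag2cat R.
Proof.
refine (@Dag2Cat R (obj C) (fun a b => mor C b a)
  (fun a b X Y => cell C X Y) (fun a => unit1 a)
  (fun a b c X Y => Y ⊠ X) (fun a b X => id2 X)
  (fun a b X Y Z g f => g ∘ f) (fun a b c X X' Y Y' f g => g ⊡ f)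
  (fun a b X Y f => f^†) (fun a b c d X Y Z => (assoc Z Y X)^†)
  (fun a b X => runit X) (fun a b X => lunit X)
  _ _ _ _ _ _ _ _ _ _ _ _ _ _ _ _ _ _ _ _ _ _ _ _) => *.
- exact: vcompA.
- exact: vcomp1l.
- exact: vcomp1r.
- exact: hcomp1.
- exact: interchange.
- exact: vcomp_linear_l.
- exact: vcomp_linear_r.
- exact: hcomp_linear_r.
- exact: hcomp_linear_l.
- exact: dan.
- exact: runit_nat.
- exact: lunit_nat.
- by apply: dag_inj; rewrite !dag_vcomp !dag_hcomp !dag1 !dagK vcompA pentagon.
- by rewrite -triangle -vcompA assocVr vcomp1r.
- exact: dag_antilinear.
- exact: dagK.
- exact: dag_vcomp.
- exact: dag_hcomp.
- by rewrite dagK assocVr.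
- by rewrite dagK assocVl.
- exact: runitVl.
- exact: runitVr.
- exact: lunitVl.
- exact: lunitVr.
Defined.

Lemma kelly_r (a b c : obj C) (X : mor C a b) (Y : mor C b c) :
  runit (X ⊠ Y) = (X ◁ runit Y) ∘ assoc X Y (unit1 c).
Proof.
have E := @kelly_l R op _ _ _ Y X; rewrite -[hcomp _ _]E.
by rewrite -(vcompA (runit (X ⊠ Y))) [X in _ ∘ X]assocVl vcomp1r.
Qed.

End Opposite.

(* A 1-morphism b -> b with candidate multiplication and unit. *)
Record qdata (R : realType) (C : dag2cat R) (b : obj C) := QData {
  qcar : mor C b b;
  qmul : cell C (qcar ⊠ qcar) qcar;
  quni : cell C (unit1 b) qcar
}.

Record is_qsys (R : realType) (C : dag2cat R) (b : obj C) (Q : qdata b) :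
    Prop := IsQSys {
  qsysA : qmul Q ∘ (qmul Q ▷ qcar Q) =
    qmul Q ∘ (qcar Q ◁ qmul Q) ∘ assoc (qcar Q) (qcar Q) (qcar Q);
  qsys1l : qmul Q ∘ (quni Q ▷ qcar Q) = lunit (qcar Q);
  qsys1r : qmul Q ∘ (qcar Q ◁ quni Q) = runit (qcar Q);
  qsys_frob_l : (qcar Q ◁ qmul Q) ∘ assoc (qcar Q) (qcar Q) (qcar Q) ∘
    ((qmul Q)^† ▷ qcar Q) = (qmul Q)^† ∘ qmul Q;
  qsys_frob_r : (qmul Q ▷ qcar Q) ∘ (assoc (qcar Q) (qcar Q) (qcar Q))^† ∘
    (qcar Q ◁ (qmul Q)^†) = (qmul Q)^† ∘ qmul Q;
  qsys_sep : qmul Q ∘ (qmul Q)^† = id2 (qcar Q)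
}.

Section Modules.
Variables (R : realType) (C : dag2cat R).

Record is_lmod (a b : obj C) (P : qdata a) (X : mor C a b)
    (l : cell C (qcar P ⊠ X) X) : Prop := IsLMod {
  lmodA : l ∘ (qcar P ◁ l) ∘ assoc (qcar P) (qcar P) X = l ∘ (qmul P ▷ X);
  lmod1 : l ∘ (quni P ▷ X) = lunit X;
  lmod_frob : (qmul P ▷ X) ∘ (assoc (qcar P) (qcar P) X)^† ∘ (qcar P ◁ l^†) =
    l^† ∘ l;
  lmod_frob' : (qcar P ◁ l) ∘ assoc (qcar P) (qcar P) X ∘ ((qmul P)^† ▷ X) =
    l^† ∘ l;
  lmod_sep : l ∘ l^† = id2 X
}.

Record is_rmod (a b : obj C) (Q : qdata b) (X : mor C a b)
    (r : cell C (X ⊠ qcar Q) X) : Prop := IsRMod {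
  rmodA : r ∘ (r ▷ qcar Q) = r ∘ (X ◁ qmul Q) ∘ assoc X (qcar Q) (qcar Q);
  rmod1 : r ∘ (X ◁ quni Q) = runit X;
  rmod_frob : (X ◁ qmul Q) ∘ assoc X (qcar Q) (qcar Q) ∘ (r^† ▷ qcar Q) =
    r^† ∘ r;
  rmod_frob' : (r ▷ qcar Q) ∘ (assoc X (qcar Q) (qcar Q))^† ∘
    (X ◁ (qmul Q)^†) = r^† ∘ r;
  rmod_sep : r ∘ r^† = id2 X
}.

Lemma mk_lmod (a b : obj C) (P : qdata a) (X : mor C a b)
    (l : cell C (qcar P ⊠ X) X) :
  l ∘ (qcar P ◁ l) ∘ assoc (qcar P) (qcar P) X = l ∘ (qmul P ▷ X) ->
  l ∘ (quni P ▷ X) = lunit X ->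
  (qmul P ▷ X) ∘ (assoc (qcar P) (qcar P) X)^† ∘ (qcar P ◁ l^†) = l^† ∘ l ->
  l ∘ l^† = id2 X -> is_lmod l.
Proof.
move=> hA h1 hF hS; split=> //.
move/(congr1 (@dag _ _ _ _ _ _)): hF.
by rewrite !dag_vcomp !dag_hcomp !dagK !dag1 vcompA.
Qed.

(* Intertwiners of left and of right actions. *)
Definition lmap (a b : obj C) (P : qdata a) (X Y : mor C a b)
  (l : cell C (qcar P ⊠ X) X) (l' : cell C (qcar P ⊠ Y) Y) (f : cell C X Y) :=
  f ∘ l = l' ∘ (qcar P ◁ f).

Definition rmap (a b : obj C) (Q : qdata b) (X Y : mor C a b)
  (r : cell C (X ⊠ qcar Q) X) (r' : cell C (Y ⊠ qcar Q) Y) (f : cell C X Y) :=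
  f ∘ r = r' ∘ (f ▷ qcar Q).

(* The actions on X ⊠ Y inherited from X and from Y. *)
Definition lact_tens (a b c : obj C) (P : qdata a) (X : mor C a b)
  (l : cell C (qcar P ⊠ X) X) (Y : mor C b c) :
  cell C (qcar P ⊠ (X ⊠ Y)) (X ⊠ Y) := (l ▷ Y) ∘ (assoc (qcar P) X Y)^†.

Definition ract_tens (a b c : obj C) (Q : qdata c) (X : mor C a b)
  (Y : mor C b c) (r : cell C (Y ⊠ qcar Q) Y) :
  cell C ((X ⊠ Y) ⊠ qcar Q) (X ⊠ Y) := (X ◁ r) ∘ assoc X Y (qcar Q).

End Modules.

Section LeftModules.
Variables (R : realType) (C : dag2cat R) (a : obj C) (P : qdata a).

Section Maps.
Variables (b : obj C).

Lemma lmod_dagE (X : mor C a b) (l : cell C (qcar P ⊠ X) X) : is_lmod l ->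
  l^† = (qcar P ◁ l) ∘ assoc (qcar P) (qcar P) X ∘
        (((qmul P)^† ∘ quni P) ▷ X) ∘ (lunit X)^†.
Proof.
move=> h; rewrite -rwM !vcompA lmod_frob' // -!vcompA.
by rewrite (vcompA l) lmod1 // lunitVr vcomp1r.
Qed.

Lemma lmap_id (X : mor C a b) (l : cell C (qcar P ⊠ X) X) : lmap l l (id2 X).
Proof. by rewrite /lmap vcomp1l hcomp1 vcomp1r. Qed.

Lemma lmap_comp (X Y Z : mor C a b) (l : cell C (qcar P ⊠ X) X)
    (l' : cell C (qcar P ⊠ Y) Y) (l'' : cell C (qcar P ⊠ Z) Z) g f :
  lmap l' l'' g -> lmap l l' f -> lmap l l'' (g ∘ f).
Proof.
by rewrite /lmap -vcompA => hg ->; rewrite vcompA hg -vcompA lwM.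
Qed.

Lemma lmap_dag (X Y : mor C a b) (l : cell C (qcar P ⊠ X) X)
    (l' : cell C (qcar P ⊠ Y) Y) f :
  is_lmod l -> is_lmod l' -> lmap l l' f -> lmap l' l f^†.
Proof.
move=> hl hl' hf; apply: dag_inj.
rewrite !dag_vcomp dag_hcomp dagK dag1 !lmod_dagE // !vcompA lwM hf -lwM.
rewrite -!vcompA; congr (_ ∘ _); rewrite (vc (esym (anR _ _ _))) -!vcompA.
congr (_ ∘ _); rewrite (vc (slide' _ _)) -(slide _ f) -!vcompA; congr (_ ∘ _).
apply: dag_inj; rewrite !dag_vcomp !dag_hcomp !dagK !dag1.
by rewrite lunit_nat.
Qed.

Lemma lmod_split (W Z : mor C a b) (l : cell C (qcar P ⊠ Z) Z)
    (v : cell C W Z) :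
  is_lmod l -> v^† ∘ v = id2 W -> lmap l l (v ∘ v^†) ->
  let lw := v^† ∘ l ∘ (qcar P ◁ v) in
  [/\ is_lmod lw, lmap lw l v & lmap l lw v^†].
Proof.
move=> hl hv he lw.
have mv : lmap lw l v.
  rewrite /lmap /lw !vcompA he -vcompA lwM -vcompA hv vcomp1r //.
have mv' : lmap l lw v^†.
  rewrite /lmap /lw -!vcompA lwM -he !vcompA hv vcomp1l //.
clearbody lw.
have hP : (qcar P ◁ v)^† ∘ (qcar P ◁ v) = id2 (qcar P ⊠ W).
  by rewrite dag_hcomp dag1 lwV.
have dw : (qcar P ◁ v) ∘ lw^† = l^† ∘ v.
  by apply: dag_inj; rewrite !dag_vcomp !dagK dag_hcomp dag1 mv'.
split=> //; apply: mk_lmod.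
- apply: (lcancel hv); rewrite !vcompA mv.
  rewrite -(vcompA l) lwM mv -lwM.
  rewrite -!vcompA -anR !vcompA lmodA // -!vcompA; congr (_ ∘ _).
  by rewrite slide slide'.
- by apply: (lcancel hv); rewrite vcompA mv -vcompA slide' -slide vcompA
    lmod1 // lunit_nat.
- apply: (lcancel hP); rewrite !vcompA dw.
  rewrite -(vcompA (l^†)) mv vcompA -lmod_frob // -!vcompA lwM -dw -lwM.
  by rewrite (vc (danR _ _ _)) -vcompA (vc (slide' _ _)) (vc (slide _ _)) !vcompA.
- by apply: (lcancel hv); rewrite vcompA mv -vcompA dw vcompA lmod_sep //
    vcomp1l vcomp1r.
Qed.

End Maps.

Section Tens.
Variables (b c : obj C).

Lemma lmod_tens (X : mor C a b) (Y : mor C b c) (l : cell C (qcar P ⊠ X) X) :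
  is_lmod l -> is_lmod (lact_tens l Y).
Proof.
move=> hl; rewrite /lact_tens; apply: mk_lmod.
- rewrite -lwM -!vcompA (vc (danM _ _ _)) -!vcompA.
  rewrite (vcompA (assoc _ _ _)^†) pent5 danL !vcompA !rwM.
  by rewrite -lmodA // !vcompA.
- by rewrite -vcompA danL vcompA rwM lmod1 // -kelly_l -vcompA assocVr vcomp1r.
- rewrite dag_vcomp dagK dag_hcomp dag1 -lwM !vcompA -(vcompA (qmul P ▷ _)).
  rewrite pent4 !vcompA -anL -!vcompA danM (vcompA (_ ▷ Y) (_ ▷ Y)) !rwM.
  rewrite (vcompA (_ ▷ Y) (_ ▷ Y)) rwM lmod_frob //.
  by rewrite -rwM -!vcompA.
- by rewrite dag_vcomp dagK dag_hcomp dag1 -!vcompA (vc1 (assocVl _ _ _)) rwV //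
    lmod_sep.
Qed.

Lemma lmap_tens (X X' : mor C a b) (Y Y' : mor C b c)
    (l : cell C (qcar P ⊠ X) X) (l' : cell C (qcar P ⊠ X') X') f
    (g : cell C Y Y') :
  lmap l l' f -> lmap (lact_tens l Y) (lact_tens l' Y') (f ⊡ g).
Proof.
move=> hf; rewrite /lmap /lact_tens vcompA interchange vcomp1r hf.
by rewrite -vcompA dan vcompA interchange vcomp1l.
Qed.

Lemma lmap_assoc (d : obj C) (X : mor C a b) (Y : mor C b c) (Z : mor C c d)
    (l : cell C (qcar P ⊠ X) X) :
  lmap (lact_tens (lact_tens l Y) Z) (lact_tens l (Y ⊠ Z)) (assoc X Y Z).
Proof.
rewrite /lmap /lact_tens -rwM -vcompA (vcompA (assoc X Y Z)) anL.
by rewrite -vcompA (vcompA (assoc (qcar P ⊠ X) Y Z)) -pent4 -!vcompA.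
Qed.

End Tens.
End LeftModules.

(* Right modules are left modules of the opposite 2-category. *)
Section RightModules.
Variables (R : realType) (C : dag2cat R) (c : obj C) (Q : qdata c).

Let Qop : @qdata R (op C) c := @QData R (op C) c (qcar Q) (qmul Q) (quni Q).

Lemma rmod_op (b : obj C) (X : mor C b c) (r : cell C (X ⊠ qcar Q) X) :
  is_rmod r -> @is_lmod R (op C) c b Qop X r.
Proof.
case=> hA h1 hF hF' hS; split=> //=.
- by rewrite hA -vcompA assocVr vcomp1r.
- by rewrite dagK.
Qed.

Lemma op_rmod (b : obj C) (X : mor C b c) (r : cell C (X ⊠ qcar Q) X) :
  @is_lmod R (op C) c b Qop X r -> is_rmod r.
Proof.
case=> /= hA h1; rewrite dagK => hF hF' hS; split=> //.
by rewrite -hA -vcompA assocVl vcomp1r.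
Qed.

Lemma ract_tens_op (a b : obj C) (X : mor C a b) (Y : mor C b c)
    (r : cell C (Y ⊠ qcar Q) Y) :
  ract_tens X r = @lact_tens R (op C) c b a Qop Y r X.
Proof. by rewrite /ract_tens /lact_tens /= dagK. Qed.

Lemma rmap_id (b : obj C) (X : mor C b c) (r : cell C (X ⊠ qcar Q) X) :
  rmap r r (id2 X).
Proof. exact: (@lmap_id R (op C) c Qop b X r). Qed.

Lemma rmap_comp (b : obj C) (X Y Z : mor C b c) (r : cell C (X ⊠ qcar Q) X)
    (r' : cell C (Y ⊠ qcar Q) Y) (r'' : cell C (Z ⊠ qcar Q) Z) g f :
  rmap r' r'' g -> rmap r r' f -> rmap r r'' (g ∘ f).
Proof. exact: (@lmap_comp R (op C) c Qop b X Y Z r r' r'' g f). Qed.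

Lemma rmap_dag (b : obj C) (X Y : mor C b c) (r : cell C (X ⊠ qcar Q) X)
    (r' : cell C (Y ⊠ qcar Q) Y) f :
  is_rmod r -> is_rmod r' -> rmap r r' f -> rmap r' r f^†.
Proof.
move=> /rmod_op hr /rmod_op hr'.
exact: (@lmap_dag R (op C) c Qop b X Y r r' f hr hr').
Qed.

Lemma rmod_split (b : obj C) (W Z : mor C b c) (r : cell C (Z ⊠ qcar Q) Z)
    (v : cell C W Z) :
  is_rmod r -> v^† ∘ v = id2 W -> rmap r r (v ∘ v^†) ->
  let rw := v^† ∘ r ∘ (v ▷ qcar Q) in
  [/\ is_rmod rw, rmap rw r v & rmap r rw v^†].
Proof.
move=> /rmod_op hr hv he.
have [/op_rmod h1 h2 h3] := @lmod_split R (op C) c Qop b W Z r v hr hv he.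
by split.
Qed.

Lemma rmod_tens (a b : obj C) (X : mor C a b) (Y : mor C b c)
  (r : cell C (Y ⊠ qcar Q) Y) : is_rmod r -> is_rmod (ract_tens X r).
Proof.
move=> /rmod_op hr; rewrite ract_tens_op; apply: op_rmod.
exact: (@lmod_tens R (op C) c Qop b a Y X r hr).
Qed.

Lemma rmap_tens (a b : obj C) (X X' : mor C a b) (Y Y' : mor C b c)
    (r : cell C (Y ⊠ qcar Q) Y) (r' : cell C (Y' ⊠ qcar Q) Y')
    (g : cell C X X') f :
  rmap r r' f -> rmap (ract_tens X r) (ract_tens X' r') (g ⊡ f).
Proof.
move=> hf; rewrite !ract_tens_op.
exact: (@lmap_tens R (op C) c Qop b a Y Y' X X' r r' f g hf).
Qed.

Lemma rmap_assoc (a b d : obj C) (X : mor C a b) (Y : mor C b d)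
    (Z : mor C d c) (r : cell C (Z ⊠ qcar Q) Z) :
  is_rmod r ->
  rmap (ract_tens (X ⊠ Y) r) (ract_tens X (ract_tens Y r)) (assoc X Y Z).
Proof.
move=> /rmod_op hr; rewrite !ract_tens_op -[assoc X Y Z]dagK.
have hl := @lmap_assoc R (op C) c Qop d b a Z Y X r.
have h1 := @lmod_tens R (op C) c Qop d a Z (X ⊠ Y) r hr.
have h2 := @lmod_tens R (op C) c Qop b a _ X _
  (@lmod_tens R (op C) c Qop d b Z Y r hr).
exact: (@lmap_dag R (op C) c Qop a _ _ _ _ _ h2 h1 hl).
Qed.

End RightModules.

(* The projection of X ⊠ Y onto X ⊗_Q Y. *)
Section RelativeProjection.
Variables (R : realType) (C : dag2cat R).

Definition relproj (a b c : obj C) (Q : qdata b) (X : mor C a b)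
    (Y : mor C b c) (r : cell C (X ⊠ qcar Q) X) (l : cell C (qcar Q ⊠ Y) Y) :
  cell C (X ⊠ Y) (X ⊠ Y) := (X ◁ l) ∘ assoc X (qcar Q) Y ∘ (r^† ▷ Y).

Lemma rmod_dagE (a b : obj C) (Q : qdata b) (X : mor C a b)
    (r : cell C (X ⊠ qcar Q) X) : is_rmod r ->
  r^† = (r ▷ qcar Q) ∘ (assoc X (qcar Q) (qcar Q))^† ∘
        (X ◁ ((qmul Q)^† ∘ quni Q)) ∘ (runit X)^†.
Proof. by move=> /rmod_op h; apply: (lmod_dagE h). Qed.

Section One.
Variables (a b c : obj C) (Q : qdata b) (X : mor C a b) (Y : mor C b c).
Variables (r : cell C (X ⊠ qcar Q) X) (l : cell C (qcar Q ⊠ Y) Y).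
Hypotheses (hr : is_rmod r) (hl : is_lmod l).

Lemma relproj_dag : (relproj r l)^† = relproj r l.
Proof.
rewrite /relproj !dag_vcomp !dag_hcomp !dagK !dag1 (lmod_dagE hl) (rmod_dagE hr).
move: ((qmul Q)^† ∘ quni Q) => e.
have E : assoc X (qcar Q ⊠ qcar Q) Y ∘ ((X ◁ e) ▷ Y) ∘ ((runit X)^† ▷ Y) =
   (X ◁ (e ▷ Y)) ∘ (X ◁ (lunit Y)^†).
  rewrite anM -vcompA; congr (_ ∘ _).
  apply: (@rcancel _ _ _ _ _ _ _ (runit X ▷ Y)).
    by rewrite dag_hcomp dag1 rwV // runitVr.
  rewrite -vcompA rwV ?runitVl // vcomp1r -triangle vcompA.
  by rewrite lwV ?lunitVl // vcomp1l.
rewrite -!lwM -!rwM -!vcompA. rewrite (vc (danR _ _ _)) (vc (anL _ _ _)) -!vcompA.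
rewrite (vc (slide _ _)) (vc (slide' _ _)); congr (_ ∘ _).
by rewrite -E !vcompA pent4 -!vcompA (vc1 (assocVl _ _ _)).
Qed.

Lemma relproj_bal :
  relproj r l ∘ (r ▷ Y) = relproj r l ∘ (X ◁ l) ∘ assoc X (qcar Q) Y.
Proof.
rewrite /relproj -vcompA rwM -rmod_frob // -!rwM.
rewrite -!vcompA (vc (slide r^† l)) -(slide' r^† l) -!vcompA.
rewrite (vc (anR _ _ _)) -!vcompA -anL (vcompA (assoc X (qcar Q) (qcar Q ⊠ Y))) -pentagon.
rewrite (vc (anM _ _ _)) -!vcompA !(vcompA (X ◁ _) (X ◁ _)) !lwM.
by rewrite -lmodA // -lwM -!vcompA.
Qed.

Lemma relproj_idem : relproj r l ∘ relproj r l = relproj r l.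
Proof.
rewrite {2}/relproj !vcompA -relproj_bal -vcompA rwM rmod_sep //.
by rewrite hcomp1 vcomp1r.
Qed.

End One.

Lemma relproj_nat (a b c : obj C) (Q : qdata b) (X X' : mor C a b)
    (Y Y' : mor C b c) (r : cell C (X ⊠ qcar Q) X) (l : cell C (qcar Q ⊠ Y) Y)
    (r' : cell C (X' ⊠ qcar Q) X') (l' : cell C (qcar Q ⊠ Y') Y') f g :
  is_rmod r -> is_rmod r' -> rmap r r' f -> lmap l l' g ->
  (f ⊡ g) ∘ relproj r l = relproj r' l' ∘ (f ⊡ g).
Proof.
move=> hr hr' hf hg.
have hf' : r'^† ∘ f = (f ▷ qcar Q) ∘ r^†.
  have := rmap_dag hr hr' hf => /(congr1 (@dag _ _ _ _ _ _)).
  by rewrite !dag_vcomp dag_hcomp dagK dag1.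
rewrite /relproj -!vcompA interchange vcomp1l hf'.
rewrite (vcompA (f ⊡ g)) interchange vcomp1r hg -slide' -lwM.
rewrite -[X in X ∘ _]vcompA slide' -!vcompA; congr (_ ∘ _).
rewrite vcompA -assoc_nat -vcompA; congr (_ ∘ _).
by rewrite interchange vcomp1r.
Qed.

Lemma relproj_lmap (a b c d : obj C) (P : qdata d) (Q : qdata b)
    (X : mor C d b) (Y : mor C b c) (lX : cell C (qcar P ⊠ X) X)
    (r : cell C (X ⊠ qcar Q) X) (l : cell C (qcar Q ⊠ Y) Y) :
  is_rmod r -> r ∘ (lX ▷ qcar Q) = lX ∘ (qcar P ◁ r) ∘ assoc _ _ _ ->
  is_lmod lX ->
  lmap (lact_tens lX Y) (lact_tens lX Y) (relproj r l).
Proof.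
move=> hr hc hl; apply: lmap_comp; last first.
  apply: lmap_tens; apply: (lmap_dag _ _ (l := lact_tens lX (qcar Q))) => //.
    exact: lmod_tens.
  by rewrite /lmap /lact_tens !vcompA hc -vcompA assocVr vcomp1r.
apply: lmap_comp; last exact: lmap_assoc.
by apply: lmap_tens; exact: lmap_id.
Qed.

Lemma relproj_rmap (a b c d : obj C) (P : qdata d) (Q : qdata b)
    (X : mor C a b) (Y : mor C b d) (rY : cell C (Y ⊠ qcar P) Y)
    (r : cell C (X ⊠ qcar Q) X) (l : cell C (qcar Q ⊠ Y) Y) :
  is_rmod r -> is_lmod l ->
  rY ∘ (l ▷ qcar P) = l ∘ (qcar Q ◁ rY) ∘ assoc _ _ _ ->
  is_rmod rY ->
  rmap (ract_tens X rY) (ract_tens X rY) (relproj r l).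
Proof.
move=> hr hl hc hrY; apply: rmap_comp; last first.
  by apply: rmap_tens; exact: rmap_id.
apply: rmap_comp; last exact: rmap_assoc.
by apply: rmap_tens; rewrite /rmap /ract_tens vcompA -hc.
Qed.

End RelativeProjection.

Section Bimodules.
Variables (R : realType) (C : dag2cat R).

Record bimod (a b : obj C) (P : qdata a) (Q : qdata b) := Bimod {
  bcar :> mor C a b;
  lact : cell C (qcar P ⊠ bcar) bcar;
  ract : cell C (bcar ⊠ qcar Q) bcar;
  lactP : is_lmod lact;
  ractP : is_rmod ract;
  actC : ract ∘ (lact ▷ qcar Q) =
    lact ∘ (qcar P ◁ ract) ∘ assoc (qcar P) bcar (qcar Q)
}.

(* The 2-morphisms of QSys(C) form a linear subspace of those of C. *)
Section Bicells.
Variables (a b : obj C) (P : qdata a) (Q : qdata b) (X Y : bimod P Q).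

Definition bimodular : {pred cell C X Y} := fun f =>
  `[< f ∘ lact X = lact Y ∘ (qcar P ◁ f) /\
      f ∘ ract X = ract Y ∘ (f ▷ qcar Q) >].

Lemma bimodularP (f : cell C X Y) :
  reflect (lmap (lact X) (lact Y) f /\ rmap (ract X) (ract Y) f)
    (f \in bimodular).
Proof. exact: asboolP. Qed.

Lemma bimodular_submod_closed : submod_closed bimodular.
Proof.
have lin0 (U V : lmodType R[i]) (g : U -> V) : linear g -> g 0 = 0.
  move=> lg; have := lg 1 0 0; rewrite !scale1r addr0 => /eqP.
  by rewrite -subr_eq subrr eq_sym => /eqP.
split=> [|k f g /bimodularP[lf rf] /bimodularP[lg rg]]; apply/bimodularP.
  rewrite /lmap /rmap.
  rewrite !(lin0 _ _ _ (vcomp_linear_l _)) (lin0 _ _ _ (hcomp_linear_l _)).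
  by rewrite (lin0 _ _ _ (hcomp_linear_r _)) !(lin0 _ _ _ (vcomp_linear_r _)).
rewrite /lmap /rmap !vcomp_linear_l hcomp_linear_l hcomp_linear_r.
by rewrite !vcomp_linear_r lf rf lg rg.
Qed.

HB.instance Definition _ :=
  GRing.isSubmodClosed.Build R[i] (cell C X Y) bimodular
    bimodular_submod_closed.

Record bicell := Bicell { bval : cell C X Y; _ : bval \in bimodular }.

HB.instance Definition _ := [isSub for bval].
HB.instance Definition _ := [Choice of bicell by <:].
HB.instance Definition _ := [SubChoice_isSubLmodule of bicell by <:].

Lemma bicell_l (f : bicell) : lmap (lact X) (lact Y) (bval f).
Proof. by case: f => f /= /bimodularP[]. Qed.

Lemma bicell_r (f : bicell) : rmap (ract X) (ract Y) (bval f).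
Proof. by case: f => f /= /bimodularP[]. Qed.

Definition mk_bicell (f : cell C X Y) (hl : lmap (lact X) (lact Y) f)
  (hr : rmap (ract X) (ract Y) f) : bicell :=
  Bicell (introT (bimodularP f) (conj hl hr)).

Lemma bvalD (k : R[i]) (f g : bicell) :
  bval (k *: f + g) = k *: bval f + bval g.
Proof. by []. Qed.

End Bicells.
End Bimodules.

Section RelativeTensor.
Variables (R : realType) (C : dag2cat R) (hC : cauchy_complete C).

Lemma lmod_quot (a b : obj C) (P : qdata a) (W Z : mor C a b)
    (l : cell C (qcar P ⊠ Z) Z) (u : cell C Z W) :
  is_lmod l -> u ∘ u^† = id2 W -> lmap l l (u^† ∘ u) ->
  let lw := u ∘ l ∘ (qcar P ◁ u^†) in
  [/\ is_lmod lw, lmap lw l u^† & lmap l lw u].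
Proof.
move=> hl hu he; have := @lmod_split R C a P b W Z l u^† hl.
by rewrite dagK => /(_ hu he).
Qed.

Lemma rmod_quot (b c : obj C) (Q : qdata c) (W Z : mor C b c)
    (r : cell C (Z ⊠ qcar Q) Z) (u : cell C Z W) :
  is_rmod r -> u ∘ u^† = id2 W -> rmap r r (u^† ∘ u) ->
  let rw := u ∘ r ∘ (u^† ▷ qcar Q) in
  [/\ is_rmod rw, rmap rw r u^† & rmap r rw u].
Proof.
move=> hr hu he; have := @rmod_split R C c Q b W Z r u^† hr.
by rewrite dagK => /(_ hu he).
Qed.

Section One.
Variables (a b c : obj C) (P : qdata a) (Q : qdata b) (S : qdata c).
Variables (X : bimod P Q) (Y : bimod Q S).

Let p := relproj (ract X) (lact Y).

Lemma relsplit_ex : exists s : {W : mor C a c & cell C (X ⊠ Y) W},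
  projT2 s ∘ (projT2 s)^† = id2 (projT1 s) /\ (projT2 s)^† ∘ projT2 s = p.
Proof.
have [|W [v [hv hp]]] := projections_split hC (p := p).
  split; first exact: relproj_idem (ractP X) (lactP Y).
  exact: relproj_dag (ractP X) (lactP Y).
by exists (existT _ W v^†); rewrite /= dagK.
Qed.

(* X ⊗_Q Y and the coisometry u_{X,Y} onto it, chosen by splitting. *)
Definition relcar : mor C a c := projT1 (proj1_sig (cid relsplit_ex)).

Definition relu : cell C (X ⊠ Y) relcar := projT2 (proj1_sig (cid relsplit_ex)).

Lemma reluV : relu ∘ relu^† = id2 relcar.
Proof. by have [] := proj2_sig (cid relsplit_ex). Qed.

Lemma relu_proj :
  relu^† ∘ relu = (X ◁ lact Y) ∘ assoc X (qcar Q) Y ∘ ((ract X)^† ▷ Y).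
Proof. by have [] := proj2_sig (cid relsplit_ex). Qed.

Lemma reluE : relu^† ∘ relu = relproj (ract X) (lact Y).
Proof. exact: relu_proj. Qed.

Definition rellact : cell C (qcar P ⊠ relcar) relcar :=
  relu ∘ lact_tens (lact X) Y ∘ (qcar P ◁ relu^†).

Definition relract : cell C (relcar ⊠ qcar S) relcar :=
  relu ∘ ract_tens X (ract Y) ∘ (relu^† ▷ qcar S).

Lemma rellactP :
  [/\ is_lmod rellact, lmap rellact (lact_tens (lact X) Y) relu^† &
      lmap (lact_tens (lact X) Y) rellact relu].
Proof.
apply: lmod_quot; [exact: lmod_tens (lactP X) | exact: reluV |].
rewrite reluE.
exact: relproj_lmap (ractP X) (actC X) (lactP X).
Qed.

Lemma relractP :
  [/\ is_rmod relract, rmap relract (ract_tens X (ract Y)) relu^† &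
      rmap (ract_tens X (ract Y)) relract relu].
Proof.
apply: rmod_quot; [exact: rmod_tens (ractP Y) | exact: reluV |].
rewrite reluE.
exact: relproj_rmap (ractP X) (lactP Y) (actC Y) (ractP Y).
Qed.

Lemma tens_actC (X0 : mor C a b) (Y0 : mor C b c) (l : cell C (qcar P ⊠ X0) X0)
  (r : cell C (Y0 ⊠ qcar S) Y0) :
  ract_tens X0 r ∘ (lact_tens l Y0 ▷ qcar S) =
  lact_tens l Y0 ∘ (qcar P ◁ ract_tens X0 r) ∘ assoc _ _ _.
Proof.
rewrite /ract_tens /lact_tens -rwM -lwM -!vcompA (vc (anL _ _ _)).
rewrite (vc (danR _ _ _)) -!vcompA (vc (slide _ _)) (vc (slide' _ _)).
by congr (_ ∘ _); rewrite -pent3 vcompA.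
Qed.

Lemma relactC : relract ∘ (rellact ▷ qcar S) =
  rellact ∘ (qcar P ◁ relract) ∘ assoc (qcar P) relcar (qcar S).
Proof.
have [_ _ ml] := rellactP; have [_ _ mr] := relractP.
move: rellact relract ml mr => lw rw ml mr.
apply: (@rcancel _ _ _ _ _ _ _ ((qcar P ◁ relu) ▷ qcar S)).
  rewrite !dag_hcomp !dag1 rwM lwM reluV !hcomp1 //.
rewrite -!vcompA rwM -ml -rwM vcompA. rewrite -mr -vcompA tens_actC.
rewrite anM (vcompA (_ ◁ _)) lwM -mr -(lwM _ relu) !vcompA -ml.
by rewrite /lact_tens !vcompA.
Qed.

Lemma rellact_mod : is_lmod rellact. Proof. by have [] := rellactP. Qed.

Lemma relract_mod : is_rmod relract. Proof. by have [] := relractP. Qed.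

Definition reltens : bimod P S := Bimod rellact_mod relract_mod relactC.

Lemma relu_p : relu ∘ relproj (ract X) (lact Y) = relu.
Proof. by rewrite -reluE vcompA reluV vcomp1l. Qed.

Lemma relu_bal :
  relu ∘ (ract X ▷ Y) = relu ∘ (X ◁ lact Y) ∘ assoc X (qcar Q) Y.
Proof.
rewrite -relu_p -(vcompA _ (relproj _ _)) (relproj_bal (ractP X) (lactP Y)).
by rewrite -(vcompA _ (relproj _ _) (X ◁ _)) -(vcompA relu).
Qed.

Lemma relu_epi (Z : mor C a c) (f g : cell C relcar Z) :
  f ∘ relu = g ∘ relu -> f = g.
Proof. exact: rcancel reluV. Qed.

End One.
Arguments relu {a b c P Q S} X Y.
Arguments reltens {a b c P Q S} X Y.

Section Maps.
Variables (a b c : obj C) (P : qdata a) (Q : qdata b) (S : qdata c).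
Variables (X X' : bimod P Q) (Y Y' : bimod Q S).
Variables (f : bicell X X') (g : bicell Y Y').

Definition relhcomp0 : cell C (reltens X Y) (reltens X' Y') :=
  relu X' Y' ∘ (bval f ⊡ bval g) ∘ (relu X Y)^†.

Lemma relhcomp_l : lmap (lact (reltens X Y)) (lact (reltens X' Y')) relhcomp0.
Proof.
have [_ h1 _] := rellactP X Y; have [_ _ h2] := rellactP X' Y'.
apply: lmap_comp h1; apply: lmap_comp h2 _; apply: lmap_tens.
exact: bicell_l.
Qed.

Lemma relhcomp_r : rmap (ract (reltens X Y)) (ract (reltens X' Y')) relhcomp0.
Proof.
have [_ h1 _] := relractP X Y; have [_ _ h2] := relractP X' Y'.
apply: rmap_comp h1; apply: rmap_comp h2 _; apply: rmap_tens.
exact: bicell_r.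
Qed.

Definition relhcomp : bicell (reltens X Y) (reltens X' Y') :=
  mk_bicell relhcomp_l relhcomp_r.

Lemma relhcompu :
  bval relhcomp ∘ relu X Y = relu X' Y' ∘ (bval f ⊡ bval g).
Proof.
rewrite /= /relhcomp0 -!vcompA reluE.
rewrite (relproj_nat (ractP X) (ractP X') (bicell_r f) (bicell_l g)).
by rewrite vcompA relu_p.
Qed.

End Maps.

Section ProjAssoc.
Variables (a b c d : obj C).

Lemma relproj_assocr (Q : qdata c) (X : mor C a b) (Y : mor C b c)
    (Z : mor C c d) (r : cell C (Y ⊠ qcar Q) Y) (l : cell C (qcar Q ⊠ Z) Z) :
  assoc X Y Z ∘ relproj (ract_tens X r) l = (X ◁ relproj r l) ∘ assoc X Y Z.
Proof.
rewrite /relproj /ract_tens dag_vcomp dag_hcomp dag1 -rwM -!lwM -!vcompA.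
rewrite (vc (anR _ _ _)) -!vcompA; congr (_ ∘ _).
rewrite (vcompA (assoc X Y _)) -pentagon -!vcompA; congr (_ ∘ _).
by rewrite (vcompA (assoc _ _ _ ▷ _)) rwV ?assocVr // vcomp1l anM.
Qed.

Lemma relproj_assocl (Q : qdata b) (X : mor C a b) (Y : mor C b c)
    (Z : mor C c d) (r : cell C (X ⊠ qcar Q) X) (l : cell C (qcar Q ⊠ Y) Y) :
  assoc X Y Z ∘ (relproj r l ▷ Z) = relproj r (lact_tens l Z) ∘ assoc X Y Z.
Proof.
rewrite /relproj /lact_tens -!rwM -!lwM -!vcompA.
rewrite (vc (anM _ _ _)) -!vcompA; congr (_ ∘ _).
rewrite -anL (vcompA (assoc X _ (Y ⊠ Z))) -pentagon -!vcompA.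
by rewrite (vcompA (X ◁ _^†)) lwV ?assocVl // vcomp1l.
Qed.

End ProjAssoc.

Section Assoc.
Variables (a b c d : obj C).
Variables (P : qdata a) (Q : qdata b) (S : qdata c) (T : qdata d).
Variables (X : bimod P Q) (Y : bimod Q S) (Z : bimod S T).

(* The associator a of QSys(C) is determined by a ∘ relU = relV ∘ assoc. *)
Definition relU := relu (reltens X Y) Z ∘ (relu X Y ▷ Z).
Definition relV := relu X (reltens Y Z) ∘ (X ◁ relu Y Z).

Lemma relUV : relU ∘ relU^† = id2 (reltens (reltens X Y) Z).
Proof.
rewrite /relU dag_vcomp -!vcompA dag_hcomp dag1 (vcompA (_ ▷ _)) rwV ?reluV //.
by rewrite vcomp1l reluV.
Qed.

Lemma relVV : relV ∘ relV^† = id2 (reltens X (reltens Y Z)).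
Proof.
rewrite /relV dag_vcomp -!vcompA dag_hcomp dag1 (vcompA (_ ◁ _)) lwV ?reluV //.
by rewrite vcomp1l reluV.
Qed.

Lemma relUVE :
  assoc X Y Z ∘ (relU^† ∘ relU) = relV^† ∘ relV ∘ assoc X Y Z.
Proof.
have [_ _ mr] := relractP X Y; have [_ _ ml] := rellactP Y Z.
have hU : relU^† ∘ relU =
    relproj (ract_tens X (ract Y)) (lact Z) ∘ (relproj (ract X) (lact Y) ▷ Z).
  rewrite /relU dag_vcomp -vcompA (vc (reluE _ _)).
  rewrite -(relproj_nat (rmod_tens X (ractP Y)) (ractP (reltens X Y)) mr
    (lmap_id (lact Z))).
  rewrite vcompA dag_hcomp dag1 rwM reluE.
  by apply: relproj_nat; [exact: rmod_tens (ractP Y)| exact: rmod_tens (ractP Y)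
   | exact: relproj_rmap (ractP X) (lactP Y) (actC Y) (ractP Y) | exact: lmap_id].
have hV : relV^† ∘ relV =
    (X ◁ relproj (ract Y) (lact Z)) ∘ relproj (ract X) (lact_tens (lact Y) Z).
  rewrite /relV dag_vcomp -vcompA (vc (reluE _ _)).
  rewrite -(relproj_nat (l' := lact (reltens Y Z)) (ractP X) (ractP X)
    (rmap_id (ract X)) ml).
  by rewrite vcompA dag_hcomp dag1 lwM reluE.
by rewrite hU hV (vc (relproj_assocr _ _ _)) -[LHS]vcompA relproj_assocl
  -[RHS]vcompA.
Qed.

Definition relassoc0 :
    cell C (reltens (reltens X Y) Z) (reltens X (reltens Y Z)) :=
  relu X (reltens Y Z) ∘ (X ◁ relu Y Z) ∘ assoc X Y Z ∘
  ((relu X Y)^† ▷ Z) ∘ (relu (reltens X Y) Z)^†.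

Lemma relassoc0E : relassoc0 = relV ∘ assoc X Y Z ∘ relU^†.
Proof.
by rewrite /relassoc0 /relU /relV dag_vcomp dag_hcomp dag1 !vcompA.
Qed.

Lemma relassoc0P : [/\ relassoc0 ∘ relU = relV ∘ assoc X Y Z,
  relassoc0 ∘ relassoc0^† = id2 _ & relassoc0^† ∘ relassoc0 = id2 _].
Proof.
rewrite relassoc0E; move: relU relV relUV relVV relUVE => U V hU hV hUV.
have hUV' : U ∘ ((assoc X Y Z)^† ∘ (V^† ∘ V)) = U ∘ (assoc X Y Z)^†.
  have /(congr1 (@dag _ _ _ _ _ _)) := hUV.
  rewrite !dag_vcomp !dagK => E; rewrite -E -vcompA.
  by rewrite (vc1 hU).
rewrite !dag_vcomp !dagK; split.
- by rewrite -!vcompA hUV -!vcompA (vc1 hV).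
- rewrite -!vcompA (vcompA U^† U) (vc hUV).
  by rewrite -!vcompA (vc1 hV) (vc1 (assocVr _ _ _)).
- rewrite -!vcompA (vcompA V^† V) (vcompA (assoc _ _ _)^† (V^† ∘ V)) (vc hUV').
  by rewrite -!vcompA (vc1 (assocVl _ _ _)).
Qed.

Lemma relassoc0U : relassoc0 ∘ relU = relV ∘ assoc X Y Z.
Proof. by have [] := relassoc0P. Qed.

Lemma relassoc_l :
  lmap (lact (reltens (reltens X Y) Z)) (lact (reltens X (reltens Y Z)))
    relassoc0.
Proof.
have [_ h1 _] := rellactP (reltens X Y) Z; have [_ h2 _] := rellactP X Y.
have [_ _ h3] := rellactP X (reltens Y Z); have [_ _ h4] := rellactP Y Z.
apply: lmap_comp h1; apply: lmap_comp; last exact: lmap_tens h2.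
apply: lmap_comp; last exact: lmap_assoc; apply: lmap_comp h3 _.
exact: lmap_tens (lmap_id _).
Qed.

Lemma relassoc_r :
  rmap (ract (reltens (reltens X Y) Z)) (ract (reltens X (reltens Y Z)))
    relassoc0.
Proof.
have [_ h1 _] := relractP (reltens X Y) Z; have [_ _ h2] := relractP Y Z.
have [_ _ h3] := relractP X (reltens Y Z).
apply: rmap_comp h1; apply: rmap_comp; last exact: rmap_tens (rmap_id _).
apply: rmap_comp; last exact: rmap_assoc (ractP Z).
by apply: rmap_comp h3 _; exact: rmap_tens h2.
Qed.

Definition relassoc := mk_bicell relassoc_l relassoc_r.

End Assoc.

End RelativeTensor.

Record qsys (R : realType) (C : dag2cat R) := QSys {
  qbase : obj C;
  qdat :> qdata qbase;
  qsysP : is_qsys qdat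
}.

Section Regular.
Variables (R : realType) (C : dag2cat R) (hC : cauchy_complete C).

Section Reg.
Variables (b : obj C) (Q : qdata b) (hQ : is_qsys Q).

Lemma reg_lmod : is_lmod (P := Q) (qmul Q).
Proof.
by split; [rewrite -(qsysA hQ) | exact: qsys1l | exact: qsys_frob_r
  | exact: qsys_frob_l | exact: qsys_sep].
Qed.

Lemma reg_rmod : is_rmod (Q := Q) (qmul Q).
Proof.
by split; [exact: qsysA | exact: qsys1r | exact: qsys_frob_l
  | exact: qsys_frob_r | exact: qsys_sep].
Qed.

Definition regular : bimod Q Q := Bimod reg_lmod reg_rmod (qsysA hQ).

End Reg.

Section Unitors.
Variables (a b : obj C) (P : qdata a) (Q : qdata b).
Variables (hP : is_qsys P) (hQ : is_qsys Q) (X : bimod P Q).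

Definition rellunit0 : cell C (reltens hC (regular hP) X) X :=
  lact X ∘ (relu hC (regular hP) X)^†.

Definition relrunit0 : cell C (reltens hC X (regular hQ)) X :=
  ract X ∘ (relu hC X (regular hQ))^†.

Lemma rellunitp : (relu hC (regular hP) X)^† ∘ relu hC (regular hP) X =
  (lact X)^† ∘ lact X.
Proof. by rewrite relu_proj /= (lmod_frob' (lactP X)). Qed.

Lemma relrunitp : (relu hC X (regular hQ))^† ∘ relu hC X (regular hQ) =
  (ract X)^† ∘ ract X.
Proof. by rewrite relu_proj /= (rmod_frob (ractP X)). Qed.

Lemma rellunitu : rellunit0 ∘ relu hC (regular hP) X = lact X.
Proof. by rewrite /rellunit0 -vcompA rellunitp vcompA lmod_sep ?vcomp1l //;
  exact: lactP. Qed.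

Lemma relrunitu : relrunit0 ∘ relu hC X (regular hQ) = ract X.
Proof. by rewrite /relrunit0 -vcompA relrunitp vcompA rmod_sep ?vcomp1l //;
  exact: ractP. Qed.

Lemma rellunitVr : rellunit0 ∘ rellunit0^† = id2 X.
Proof.
rewrite {2}/rellunit0 dag_vcomp dagK vcompA rellunitu lmod_sep //.
exact: lactP.
Qed.

Lemma relrunitVr : relrunit0 ∘ relrunit0^† = id2 X.
Proof.
rewrite {2}/relrunit0 dag_vcomp dagK vcompA relrunitu rmod_sep //.
exact: ractP.
Qed.

Lemma rellunitVl : rellunit0^† ∘ rellunit0 = id2 (reltens hC (regular hP) X).
Proof.
rewrite /rellunit0 dag_vcomp dagK -vcompA (vcompA (lact X)^†) -rellunitp.
by rewrite -!vcompA reluV vcomp1r reluV.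
Qed.

Lemma relrunitVl : relrunit0^† ∘ relrunit0 = id2 (reltens hC X (regular hQ)).
Proof.
rewrite /relrunit0 dag_vcomp dagK -vcompA (vcompA (ract X)^†) -relrunitp.
by rewrite -!vcompA reluV vcomp1r reluV.
Qed.

Lemma rellunit_l :
  lmap (lact (reltens hC (regular hP) X)) (lact X) rellunit0.
Proof.
have [_ h _] := rellactP hC (regular hP) X; apply: lmap_comp h.
by rewrite /lmap /lact_tens vcompA -(lmodA (lactP X)) -!vcompA assocVr vcomp1r.
Qed.

Lemma rellunit_r :
  rmap (ract (reltens hC (regular hP) X)) (ract X) rellunit0.
Proof.
have [_ h _] := relractP hC (regular hP) X; apply: rmap_comp h.
by rewrite /rmap /ract_tens vcompA actC.
Qed.

Lemma relrunit_l :
  lmap (lact (reltens hC X (regular hQ))) (lact X) relrunit0.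
Proof.
have [_ h _] := rellactP hC X (regular hQ); apply: lmap_comp h.
by rewrite /lmap /lact_tens vcompA actC -!vcompA assocVr vcomp1r.
Qed.

Lemma relrunit_r :
  rmap (ract (reltens hC X (regular hQ))) (ract X) relrunit0.
Proof.
have [_ h _] := relractP hC X (regular hQ); apply: rmap_comp h.
by rewrite /rmap /ract_tens vcompA -(rmodA (ractP X)).
Qed.

Definition rellunit := mk_bicell rellunit_l rellunit_r.
Definition relrunit := mk_bicell relrunit_l relrunit_r.

End Unitors.

Section Cells.
Variables (a b : obj C) (P : qdata a) (Q : qdata b).

Definition bicell_id (X : bimod P Q) : bicell X X :=
  mk_bicell (lmap_id (lact X)) (rmap_id (ract X)).

Definition bicell_comp (X Y Z : bimod P Q) (g : bicell Y Z) (f : bicell X Y) :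
    bicell X Z :=
  mk_bicell (lmap_comp (bicell_l g) (bicell_l f))
    (rmap_comp (bicell_r g) (bicell_r f)).

Definition bicell_dag (X Y : bimod P Q) (f : bicell X Y) : bicell Y X :=
  mk_bicell (lmap_dag (lactP X) (lactP Y) (bicell_l f))
    (rmap_dag (ractP X) (ractP Y) (bicell_r f)).

End Cells.

Section Coherence.
Variables (a b c d e : obj C).
Variables (P : qdata a) (Q : qdata b) (S : qdata c) (T : qdata d) (N : qdata e).

Lemma relassoc_nat (X X' : bimod P Q) (Y Y' : bimod Q S) (Z Z' : bimod S T)
    (f : bicell X X') (g : bicell Y Y') (h : bicell Z Z') :
  relassoc0 hC X' Y' Z' ∘ bval (relhcomp hC (relhcomp hC f g) h) =
  bval (relhcomp hC f (relhcomp hC g h)) ∘ relassoc0 hC X Y Z.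
Proof.
have E1 := relhcompu hC (relhcomp hC f g) h; have E2 := relhcompu hC f g.
have E3 := relhcompu hC f (relhcomp hC g h); have E4 := relhcompu hC g h.
have E5 := relassoc0U hC X Y Z; have E6 := relassoc0U hC X' Y' Z'.
apply: (rcancel (relUV hC X Y Z)); rewrite -[RHS]vcompA E5.
move: (relassoc0 hC X' Y' Z') E6 => A E6 {E5}.
move: (bval (relhcomp hC (relhcomp hC f g) h)) E1 => F E1.
move: (bval (relhcomp hC f (relhcomp hC g h))) E3 => G E3.
move: (bval (relhcomp hC f g)) E2 E1 => F' E2 E1.
move: (bval (relhcomp hC g h)) E4 E3 => G' E4 E3.
rewrite /relU /relV in E6 *.
have L : (F' ⊡ bval h) ∘ (relu hC X Y ▷ Z) =
    (relu hC X' Y' ▷ Z') ∘ ((bval f ⊡ bval g) ⊡ bval h).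
  by rewrite !interchange vcomp1r vcomp1l E2.
have L' : (bval f ⊡ G') ∘ (X ◁ relu hC Y Z) =
    (X' ◁ relu hC Y' Z') ∘ (bval f ⊡ (bval g ⊡ bval h)).
  by rewrite !interchange vcomp1r vcomp1l E4.
rewrite -!vcompA (vc E1) (vc E3) -!vcompA L (vc L') -!vcompA.
rewrite (vcompA (relu hC (reltens hC X' Y') Z')) (vc E6) -!vcompA.
by rewrite assoc_nat.
Qed.

Lemma rellunit_nat (X Y : bimod P Q) (hP : is_qsys P) (f : bicell X Y) :
  rellunit0 hP Y ∘ bval (relhcomp hC (bicell_id (regular hP)) f) =
  bval f ∘ rellunit0 hP X.
Proof.
apply: (relu_epi (hC := hC)); rewrite -[LHS]vcompA -[RHS]vcompA relhcompu rellunitu.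
by rewrite vcompA rellunitu (bicell_l f).
Qed.

Lemma relrunit_nat (X Y : bimod P Q) (hQ : is_qsys Q) (f : bicell X Y) :
  relrunit0 hQ Y ∘ bval (relhcomp hC f (bicell_id (regular hQ))) =
  bval f ∘ relrunit0 hQ X.
Proof.
apply: (relu_epi (hC := hC)); rewrite -[LHS]vcompA -[RHS]vcompA relhcompu relrunitu.
by rewrite vcompA relrunitu (bicell_r f).
Qed.

Lemma reltriangle (hQ : is_qsys Q) (X : bimod P Q) (Y : bimod Q S) :
  bval (relhcomp hC (bicell_id X) (rellunit hQ Y)) ∘
    relassoc0 hC X (regular hQ) Y =
  bval (relhcomp hC (relrunit hQ X) (bicell_id Y)).
Proof.
have E1 := relhcompu hC (bicell_id X) (rellunit hQ Y).
have E2 := relhcompu hC (relrunit hQ X) (bicell_id Y).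
have E3 := relassoc0U hC X (regular hQ) Y.
apply: (rcancel (relUV hC X (regular hQ) Y)); rewrite -[LHS]vcompA E3.
move: (bval (relhcomp hC (bicell_id X) (rellunit hQ Y))) E1 => F E1.
move: (bval (relhcomp hC (relrunit hQ X) (bicell_id Y))) E2 => G E2.
rewrite /relU /relV (vcompA F) (vcompA F) E1 vcompA E2 -!vcompA rwM.
rewrite [bval (rellunit _ _)]/= [bval (relrunit _ _)]/= relrunitu relu_bal.
by rewrite (vcompA (_ ◁ _)) lwM rellunitu vcompA.
Qed.

Lemma relpentagon (W : bimod P Q) (X : bimod Q S) (Y : bimod S T)
    (Z : bimod T N) :
  bval (relhcomp hC (bicell_id W) (relassoc hC X Y Z)) ∘
    relassoc0 hC W (reltens hC X Y) Z ∘
    bval (relhcomp hC (relassoc hC W X Y) (bicell_id Z)) =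
  relassoc0 hC W X (reltens hC Y Z) ∘ relassoc0 hC (reltens hC W X) Y Z.
Proof.
have E1 := relhcompu hC (bicell_id W) (relassoc hC X Y Z).
have E2 := relhcompu hC (relassoc hC W X Y) (bicell_id Z).
have A1 := relassoc0U hC W (reltens hC X Y) Z.
have A2 := relassoc0U hC W X (reltens hC Y Z).
have A3 := relassoc0U hC (reltens hC W X) Y Z.
have A4 := relassoc0U hC X Y Z; have A5 := relassoc0U hC W X Y.
have epi1 := relUV hC (reltens hC W X) Y Z.
apply: (rcancel epi1).
apply: (@rcancel _ _ _ _ _ _ _ ((relu hC W X ▷ Y) ▷ Z)).
  by rewrite !dag_hcomp !dag1 !rwM reluV !hcomp1.
rewrite -(vcompA _ (relassoc0 hC (reltens hC W X) Y Z)) A3 {A3 epi1}.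
move: (bval (relhcomp hC (bicell_id W) (relassoc hC X Y Z))) E1 => F E1.
move: (bval (relhcomp hC (relassoc hC W X Y) (bicell_id Z))) E2 => G E2.
rewrite /= in E1 E2.
move: (relassoc0 hC W (reltens hC X Y) Z) A1 => a1 A1.
move: (relassoc0 hC W X (reltens hC Y Z)) A2 => a2 A2.
move: (relassoc0 hC X Y Z) A4 E1 => a4 A4 E1.
move: (relassoc0 hC W X Y) A5 E2 => a5 A5 E2.
rewrite /relU /relV in A1 A2 A4 A5 *.
have L1 : (a5 ▷ Z) ∘ ((relu hC (reltens hC W X) Y ▷ Z) ∘
    ((relu hC W X ▷ Y) ▷ Z)) =
  (relu hC W (reltens hC X Y) ▷ Z) ∘ ((W ◁ relu hC X Y) ▷ Z) ∘
    (assoc W X Y ▷ Z).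
  by rewrite !rwM A5.
have L2 : (W ◁ a4) ∘ ((W ◁ relu hC (reltens hC X Y) Z) ∘
    (W ◁ (relu hC X Y ▷ Z))) =
  (W ◁ relu hC X (reltens hC Y Z)) ∘ (W ◁ (X ◁ relu hC Y Z)) ∘
    (W ◁ assoc X Y Z).
  by rewrite !lwM A4.
have L3 : (reltens hC W X ◁ relu hC Y Z) ∘ (relu hC W X ▷ (Y ⊠ Z)) =
  (relu hC W X ▷ reltens hC Y Z) ∘ ((W ⊠ X) ◁ relu hC Y Z).
  by rewrite slide slide'.
rewrite -!vcompA (vc E2) -!vcompA L1 -!vcompA.
rewrite (vcompA (relu hC (reltens hC W (reltens hC X Y)) Z)) (vc A1) -!vcompA.
rewrite (vc (anM _ _ _)) -!vcompA (vc E1) -!vcompA.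
rewrite (vcompA (W ◁ relu hC (reltens hC X Y) Z)) (vc L2) -!vcompA.
rewrite anL (vc L3) -!vcompA.
rewrite (vcompA (relu hC (reltens hC W X) (reltens hC Y Z))) (vc A2) -!vcompA.
rewrite (vc (anR _ _ _)) -!vcompA -pentagon.
by rewrite -!vcompA.
Qed.

End Coherence.

(* QSys(C) *)
Definition qsys2cat : dag2cat R.
Proof.
refine (@Dag2Cat R (qsys C) (fun P Q => bimod P Q)
  (fun P Q X Y => bicell X Y : lmodType R[i])
  (fun Q => regular (qsysP Q))
  (fun P Q S X Y => reltens hC X Y)
  (fun P Q X => bicell_id X)
  (fun P Q X Y Z g f => bicell_comp g f)
  (fun P Q S X X' Y Y' f g => relhcomp hC f g)
  (fun P Q X Y f => bicell_dag f)
  (fun P Q S T X Y Z => relassoc hC X Y Z)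
  (fun P Q X => rellunit (qsysP P) X)
  (fun P Q X => relrunit (qsysP Q) X)
  _ _ _ _ _ _ _ _ _ _ _ _ _ _ _ _ _ _ _ _ _ _ _ _).
- by move=> *; apply: val_inj; exact: vcompA.
- by move=> *; apply: val_inj; exact: vcomp1l.
- by move=> *; apply: val_inj; exact: vcomp1r.
- move=> P Q S X Y; apply: val_inj; apply: (@relu_epi _ _ hC).
  by rewrite relhcompu /= hcomp1 vcomp1l vcomp1r.
- move=> P Q S X1 X2 X3 Y1 Y2 Y3 f f' g g'; apply: val_inj.
  apply: (@relu_epi _ _ hC); rewrite relhcompu /= -vcompA.
  rewrite -[relhcomp0 _ f g]/(bval (relhcomp hC f g)) relhcompu.
  rewrite -[relhcomp0 _ f' g']/(bval (relhcomp hC f' g')) vcompA relhcompu.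
  by rewrite -vcompA interchange.
- by move=> P Q X Y Z f k g h; apply: val_inj; exact: vcomp_linear_l.
- by move=> P Q X Y Z f k g h; apply: val_inj; exact: vcomp_linear_r.
- move=> P Q S X X' Y Y' g k f f'; apply: val_inj.
  by rewrite /= /relhcomp0 /= hcomp_linear_l vcomp_linear_r vcomp_linear_l.
- move=> P Q S X X' Y Y' g k f f'; apply: val_inj.
  by rewrite /= /relhcomp0 /= hcomp_linear_r vcomp_linear_r vcomp_linear_l.
- by move=> P Q S T X X' Y Y' Z Z' f g h; apply: val_inj; exact: relassoc_nat.
- by move=> P Q X Y f; apply: val_inj; exact: rellunit_nat.
- by move=> P Q X Y f; apply: val_inj; exact: relrunit_nat.
- by move=> P Q S T N W X Y Z; apply: val_inj; exact: relpentagon.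
- by move=> P Q S X Y; apply: val_inj; exact: reltriangle.
- by move=> P Q X Y k f g; apply: val_inj; exact: dag_antilinear.
- by move=> P Q X Y f; apply: val_inj; exact: dagK.
- by move=> P Q X Y Z g f; apply: val_inj; exact: dag_vcomp.
- move=> P Q S X X' Y Y' f g; apply: val_inj.
  by rewrite /= /relhcomp0 !dag_vcomp dagK dag_hcomp vcompA.
- by move=> P Q S T X Y Z; apply: val_inj; have [] := relassoc0P hC X Y Z.
- by move=> P Q S T X Y Z; apply: val_inj; have [] := relassoc0P hC X Y Z.
- by move=> P Q X; apply: val_inj; exact: rellunitVl.
- by move=> P Q X; apply: val_inj; exact: rellunitVr.
- by move=> P Q X; apply: val_inj; exact: relrunitVl.
- by move=> P Q X; apply: val_inj; exact: relrunitVr.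
Defined.

End Regular.

Section Equivalences.
Variables (R : realType).

Definition equivalent (C : dag2cat R) (a b : obj C) :=
  exists (X : mor C a b) (Y : mor C b a)
    (eta : cell C (unit1 a) (X ⊠ Y)) (eps : cell C (Y ⊠ X) (unit1 b)),
    invertible eta /\ invertible eps.

Record dag2functor (C D : dag2cat R) := Dag2Functor {
  fobj : obj C -> obj D;
  fmor : forall a b : obj C, mor C a b -> mor D (fobj a) (fobj b);
  fcell : forall (a b : obj C) (X Y : mor C a b),
    cell C X Y -> cell D (fmor X) (fmor Y);
  ftens : forall (a b c : obj C) (X : mor C a b) (Y : mor C b c),
    cell D (fmor X ⊠ fmor Y) (fmor (X ⊠ Y));
  funit : forall a : obj C, cell D (unit1 (fobj a)) (fmor (unit1 a));

  fcell_linear : forall (a b : obj C) (X Y : mor C a b),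
    linear (@fcell a b X Y);
  fcell1 : forall (a b : obj C) (X : mor C a b), fcell (id2 X) = id2 (fmor X);
  fcellM : forall (a b : obj C) (X Y Z : mor C a b)
    (g : cell C Y Z) (f : cell C X Y), fcell (g ∘ f) = fcell g ∘ fcell f;
  fcell_dag : forall (a b : obj C) (X Y : mor C a b) (f : cell C X Y),
    fcell f^† = (fcell f)^†;
  ftens_unitary : forall (a b c : obj C) (X : mor C a b) (Y : mor C b c),
    is_unitary (ftens X Y);
  funit_unitary : forall a : obj C, is_unitary (funit a);
  ftens_nat : forall (a b c : obj C) (X X' : mor C a b) (Y Y' : mor C b c)
    (f : cell C X X') (g : cell C Y Y'),
    fcell (f ⊡ g) ∘ ftens X Y = ftens X' Y' ∘ (fcell f ⊡ fcell g);
  ftens_assoc : forall (a b c d : obj C)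
    (X : mor C a b) (Y : mor C b c) (Z : mor C c d),
    fcell (assoc X Y Z) ∘ ftens (X ⊠ Y) Z ∘ (ftens X Y ▷ fmor Z) =
    ftens X (Y ⊠ Z) ∘ (fmor X ◁ ftens Y Z) ∘
      assoc (fmor X) (fmor Y) (fmor Z);
  ftens_lunit : forall (a b : obj C) (X : mor C a b),
    fcell (lunit X) ∘ ftens (unit1 a) X ∘ (funit a ▷ fmor X) =
    lunit (fmor X);
  ftens_runit : forall (a b : obj C) (X : mor C a b),
    fcell (runit X) ∘ ftens X (unit1 b) ∘ (fmor X ◁ funit b) =
    runit (fmor X)
}.

Record is_dag2equivalence (C D : dag2cat R) (F : dag2functor C D) : Prop :=
    IsDag2Equivalence {
  equiv_obj : forall d : obj D, exists c : obj C, equivalent (fobj F c) d;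
  equiv_mor : forall (a b : obj C) (Y : mor D (fobj F a) (fobj F b)),
    exists (X : mor C a b) (u : cell D (fmor F X) Y), is_unitary u;
  equiv_cell : forall (a b : obj C) (X Y : mor C a b),
    bijective (@fcell _ _ F a b X Y)
}.

End Equivalences.

Section Inclusion.
Variables (R : realType) (C : dag2cat R).

(* By lunit_runit, lunit and runit agree on unit1 c. *)
Definition triv_qdata (c : obj C) : qdata c :=
  QData (lunit (unit1 c)) (id2 (unit1 c)).

Lemma lunit_bal (a b : obj C) (X : mor C a b) :
  (unit1 a ◁ lunit X) ∘ assoc (unit1 a) (unit1 a) X = lunit (unit1 a) ▷ X.
Proof. by rewrite triangle lunit_runit. Qed.

Lemma triv_lmod (a b : obj C) (X : mor C a b) :
  is_lmod (P := triv_qdata a) (lunit X).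
Proof.
apply: mk_lmod; rewrite /=.
- by rewrite -vcompA lunit_bal.
- by rewrite hcomp1 vcomp1r.
- rewrite -lunit_bal -!vcompA (vc1 (assocVr _ _ _)) lwV ?lunitVr //.
  by rewrite lunitVl.
- exact: lunitVr.
Qed.

End Inclusion.

Section Inclusion2.
Variables (R : realType) (C : dag2cat R).

Lemma triv_rmod (a b : obj C) (X : mor C a b) :
  is_rmod (Q := triv_qdata b) (runit X).
Proof.
apply: op_rmod; have := @triv_lmod R (op C) b a X.
by rewrite /triv_qdata /= -lunit_runit.
Qed.

Lemma triv_qsys (c : obj C) : is_qsys (triv_qdata c).
Proof.
case: (triv_lmod (unit1 c)) => /= hA h1 hf hf' hs; split=> //=.
by rewrite hcomp1 vcomp1r lunit_runit.
Qed.

Lemma triv_actC (a b : obj C) (X : mor C a b) :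
  runit X ∘ (lunit X ▷ unit1 b) =
  lunit X ∘ (unit1 a ◁ runit X) ∘ assoc (unit1 a) X (unit1 b).
Proof. by rewrite runit_nat kelly_r vcompA. Qed.

Definition triv_bimod (a b : obj C) (X : mor C a b) :
    bimod (triv_qdata a) (triv_qdata b) :=
  Bimod (triv_lmod X) (triv_rmod X) (triv_actC X).

Definition triv_bicell (a b : obj C) (X Y : mor C a b) (f : cell C X Y) :
    bicell (triv_bimod X) (triv_bimod Y) :=
  @mk_bicell R C a b _ _ (triv_bimod X) (triv_bimod Y) f
    (esym (lunit_nat f)) (esym (runit_nat f)).

Variable hC : cauchy_complete C.

Lemma triv_relu (a b c : obj C) (X : mor C a b) (Y : mor C b c) :
  (relu hC (triv_bimod X) (triv_bimod Y))^† ∘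
    relu hC (triv_bimod X) (triv_bimod Y) = id2 (X ⊠ Y).
Proof. by rewrite relu_proj /= triangle rwV // runitVr. Qed.

Section Tens.
Variables (a b c : obj C) (X : mor C a b) (Y : mor C b c).

Lemma triv_tens_l :
  lmap (lact (reltens hC (triv_bimod X) (triv_bimod Y)))
    (lact (triv_bimod (X ⊠ Y))) (relu hC (triv_bimod X) (triv_bimod Y))^†.
Proof.
have [_ h _] := rellactP hC (triv_bimod X) (triv_bimod Y).
by rewrite /lmap h /lact_tens /= -kelly_l -(vcompA (lunit _)) assocVr vcomp1r.
Qed.

Lemma triv_tens_r :
  rmap (ract (reltens hC (triv_bimod X) (triv_bimod Y)))
    (ract (triv_bimod (X ⊠ Y))) (relu hC (triv_bimod X) (triv_bimod Y))^†.
Proof.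
have [_ h _] := relractP hC (triv_bimod X) (triv_bimod Y).
by rewrite /rmap h /ract_tens /= kelly_r.
Qed.

Definition triv_tens :
    bicell (reltens hC (triv_bimod X) (triv_bimod Y)) (triv_bimod (X ⊠ Y)) :=
  mk_bicell triv_tens_l triv_tens_r.

End Tens.

Lemma triv_unit_r (c : obj C) :
  rmap (Q := triv_qdata c) (lunit (unit1 c)) (runit (unit1 c))
    (id2 (unit1 c)).
Proof. by rewrite /rmap /= lunit_runit vcomp1l hcomp1 vcomp1r. Qed.

Definition triv_unit (c : obj C) :
    bicell (regular (triv_qsys c)) (triv_bimod (unit1 c)) :=
  @mk_bicell R C c c _ _ (regular (triv_qsys c)) (triv_bimod (unit1 c))
    (id2 (unit1 c)) (@lmap_id _ _ _ (triv_qdata c) _ _ (lunit (unit1 c)))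
    (triv_unit_r c).

Definition iota : dag2functor C (qsys2cat hC).
Proof.
refine (@Dag2Functor R C (qsys2cat hC) (fun c => QSys (triv_qsys c))
  (fun a b X => triv_bimod X) (fun a b X Y f => triv_bicell f)
  (fun a b c X Y => triv_tens X Y) (fun c => triv_unit c)
  _ _ _ _ _ _ _ _ _ _).
- by move=> a b X Y k f g; apply: val_inj.
- by move=> a b X; apply: val_inj.
- by move=> a b X Y Z g f; apply: val_inj.
- by move=> a b X Y f; apply: val_inj.
- move=> a b c X Y; split; apply: val_inj; rewrite /= dagK.
    exact: reluV.
  exact: triv_relu.
- move=> c; split; apply: val_inj; rewrite /= dag1 vcomp1l //.
- move=> a b c X X' Y Y' f g; apply: val_inj.
  apply: (relu_epi (hC := hC)).
  have E := relhcompu hC (triv_bicell f) (triv_bicell g).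
  rewrite -[LHS]vcompA -[RHS]vcompA E triv_relu vcomp1r.
  by rewrite vcompA triv_relu vcomp1l.
- move=> a b c d X Y Z; apply: val_inj.
  have E1 := relhcompu hC (triv_tens X Y) (bicell_id (triv_bimod Z)).
  have E2 := relhcompu hC (bicell_id (triv_bimod X)) (triv_tens Y Z).
  have E3 := relassoc0U hC (triv_bimod X) (triv_bimod Y) (triv_bimod Z).
  change (assoc X Y Z ∘ (relu hC (triv_bimod (X ⊠ Y)) (triv_bimod Z))^† ∘
    bval (relhcomp hC (triv_tens X Y) (bicell_id (triv_bimod Z))) =
    (relu hC (triv_bimod X) (triv_bimod (Y ⊠ Z)))^† ∘
    bval (relhcomp hC (bicell_id (triv_bimod X)) (triv_tens Y Z)) ∘
    relassoc0 hC (triv_bimod X) (triv_bimod Y) (triv_bimod Z)).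
  apply: (rcancel (relUV hC (triv_bimod X) (triv_bimod Y) (triv_bimod Z))).
  rewrite -[RHS]vcompA E3 /relU /relV.
  move: (bval (relhcomp hC (triv_tens X Y) _)) E1 => F E1.
  move: (bval (relhcomp hC _ (triv_tens Y Z))) E2 => G E2.
  rewrite /= in E1 E2 *.
  rewrite -!vcompA (vc E1) (vc E2) -!vcompA !(vc1 (triv_relu _ _)).
  rewrite (vcompA (_ ◁ _)) lwM triv_relu rwM triv_relu.
  by rewrite !hcomp1 vcomp1r vcomp1l.
- move=> a b X; apply: val_inj; apply: (relu_epi (hC := hC)).
  have E := relhcompu hC (triv_unit a) (bicell_id (triv_bimod X)).
  rewrite -[LHS]vcompA E [RHS]rellunitu /=.
  by rewrite -[LHS]vcompA (vcompA _^†) triv_relu vcomp1l hcomp1 vcomp1r.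
- move=> a b X; apply: val_inj; apply: (relu_epi (hC := hC)).
  have E := relhcompu hC (bicell_id (triv_bimod X)) (triv_unit b).
  rewrite -[LHS]vcompA E [RHS]relrunitu /=.
  by rewrite -[LHS]vcompA (vcompA _^†) triv_relu vcomp1l hcomp1 vcomp1r.
Defined.

Definition qsys_complete := is_dag2equivalence iota.

End Inclusion2.

Section Splitting.
Variables (R : realType) (C : dag2cat R).

Definition qsys_iso (b : obj C) (Q Q' : qdata b) :=
  exists u : cell C (qcar Q) (qcar Q'),
    [/\ is_unitary u, u ∘ qmul Q = qmul Q' ∘ (u ⊡ u) & u ∘ quni Q = quni Q'].

Record dual (b c : obj C) (X : mor C b c) := Dual {
  dcar : mor C c b;
  ev : cell C (dcar ⊠ X) (unit1 c);
  coev : cell C (unit1 b) (X ⊠ dcar);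
  zigzag_l : runit X ∘ (X ◁ ev) ∘ assoc X dcar X ∘ (coev ▷ X) ∘ (lunit X)^† =
    id2 X;
  zigzag_r : lunit dcar ∘ (ev ▷ dcar) ∘ (assoc dcar X dcar)^† ∘
    (dcar ◁ coev) ∘ (runit dcar)^† = id2 dcar
}.

Definition unitarily_separable (b c : obj C) (X : mor C b c) (D : dual X) :=
  ev D ∘ (ev D)^† = id2 (unit1 c).

Definition dual_qdata (b c : obj C) (X : mor C b c) (D : dual X) : qdata b :=
  let V := dcar D in
  @QData R C b (X ⊠ V)
    ((X ◁ (lunit V ∘ (ev D ▷ V) ∘ (assoc V X V)^†)) ∘ assoc X V (X ⊠ V))
    (coev D).

Definition qsys_splits (b : obj C) (Q : qdata b) :=
  exists (c : obj C) (X : mor C b c) (D : dual X),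
    unitarily_separable D /\ qsys_iso Q (dual_qdata D).

Definition every_qsys_splits :=
  forall (b : obj C) (Q : qdata b), is_qsys Q -> qsys_splits Q.

End Splitting.

(* Main.v *)
From mathcomp Require Import all_boot all_order all_algebra complex.
From mathcomp Require Import boolp classical_sets reals topology normedtype.
From mathcomp Require Import sequences ring lra.
Require Import Defs.

(** A 1_a-1_b bimodule is a 1-morphism a -> b whose actions are forced by
    unitality to be the unitors, and every 2-morphism is bimodular for them.
    The inclusion of C into QSys(C) is therefore always an equivalence on hom
    categories, and C is Q-system complete exactly when every Q-system Q over b
    is equivalent, in QSys(C), to a trivial one 1_c. The theorem says that such
    Morita equivalences are the same as splittings of Q.

    From a splitting Q = X V, with V the dual of X, the contraction ev makes X a
    left and V a right Q-module ([ev_lmod], used twice thanks to the reversal of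
    1-morphisms). The projection of V X onto V (x)_Q X is then ev^† ev
    ([split_relproj]), so that ev ev^† = 1 gives a unitary from 1_c to
    V (x)_Q X, whereas X (x)_{1_c} V is X V, that is Q.

    Conversely let X : 1_c -> Q and Y : Q -> 1_c be inverse to each other in
    QSys(C). Suppose that e : X (x)_Q Y => 1_c and eps : Y (x)_{1_c} X => Q are
    unitary and satisfy X eps = e X and eps Y = Y e. Then e composed with the
    coisometry X Y => X (x)_Q Y is a coisometry ev : X Y => 1_c, the unit of Q
    transported along eps is a coevaluation, the zig-zag equations are the
    unit laws of the two actions of Q, and eps carries the multiplication
    Y ev X to that of Q ([splits_of_balanced]).

    The definition of equivalence only provides invertible 2-morphisms. The
    first is made unitary by polar decomposition ([unitary_of_invertible]), and
    eps is then determined by X eps = e X, which makes it unitary and implies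
    the other identity ([adjoint_counit]).

    Polar decomposition needs a square root of f^† f. Square roots of elements
    close to the identity are fixed points of a contraction ([sqrt_exists]),
    and they show that squares x^2 of self-adjoint elements are positive in the
    form |t - x^2| <= t ([cnorm_sub_square]). This yields a square root of
    |f^† f| and leaves a symmetry in the place of the identity, whose
    (-1)-eigenspace carries a w with w^† w = -1; the argument of Kaplansky,
    comparing g^† g with g g^†, shows that it vanishes ([no_negative]).

    A W*-2-category is in particular a C*-2-category. *)

Set Implicit Arguments.
Unset Strict Implicit.
Unset Printing Implicit Defensive.

Import Order.TTheory GRing.Theory Num.Theory numFieldNormedType.Exports.
Local Open Scope classical_set_scope.
Local Open Scope ring_scope.
Local Open Scope twocat_scope.

(** * Bilinearity of composition *)

Section Linear.
Variables (R : realType) (C : dag2cat R) (a b : obj C).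
Implicit Types X Y Z : mor C a b.

Lemma linearD_ext (U V : lmodType R[i]) (g : U -> V) :
  linear g -> {morph g : x y / x + y}.
Proof. by move=> lg x y; have := lg 1 x y; rewrite !scale1r. Qed.

Lemma linear0_ext (U V : lmodType R[i]) (g : U -> V) : linear g -> g 0 = 0.
Proof.
move=> lg; have /eqP := linearD_ext lg 0 0.
by rewrite addr0 -subr_eq subrr => /eqP.
Qed.

Lemma linearZ_ext (U V : lmodType R[i]) (g : U -> V) (k : R[i]) :
  linear g -> {morph g : x / k *: x}.
Proof. by move=> lg x; have := lg k x 0; rewrite !addr0 linear0_ext ?addr0. Qed.

Lemma vcompDl X Y Z (f f' : cell C Y Z) (g : cell C X Y) :
  (f + f') ∘ g = f ∘ g + (f' ∘ g).
Proof. exact: (linearD_ext (vcomp_linear_l g)). Qed.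

Lemma vcompDr X Y Z (f : cell C Y Z) (g g' : cell C X Y) :
  f ∘ (g + g') = f ∘ g + (f ∘ g').
Proof. exact: (linearD_ext (vcomp_linear_r f)). Qed.

Lemma vcompZl X Y Z k (f : cell C Y Z) (g : cell C X Y) :
  (k *: f) ∘ g = k *: (f ∘ g).
Proof. exact: (linearZ_ext k (vcomp_linear_l g)). Qed.

Lemma vcompZr X Y Z k (f : cell C Y Z) (g : cell C X Y) :
  f ∘ (k *: g) = k *: (f ∘ g).
Proof. exact: (linearZ_ext k (vcomp_linear_r f)). Qed.

Lemma vcompNl X Y Z (f : cell C Y Z) (g : cell C X Y) : (- f) ∘ g = - (f ∘ g).
Proof. by rewrite -scaleN1r vcompZl scaleN1r. Qed.

Lemma vcompNr X Y Z (f : cell C Y Z) (g : cell C X Y) : f ∘ (- g) = - (f ∘ g).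
Proof. by rewrite -scaleN1r vcompZr scaleN1r. Qed.

Lemma vcompBl X Y Z (f f' : cell C Y Z) (g : cell C X Y) :
  (f - f') ∘ g = f ∘ g - (f' ∘ g).
Proof. by rewrite vcompDl vcompNl. Qed.

Lemma vcompBr X Y Z (f : cell C Y Z) (g g' : cell C X Y) :
  f ∘ (g - g') = f ∘ g - (f ∘ g').
Proof. by rewrite vcompDr vcompNr. Qed.

Lemma vcomp0l X Y Z (g : cell C X Y) : (0 : cell C Y Z) ∘ g = 0.
Proof. exact: linear0_ext (vcomp_linear_l g). Qed.

Lemma vcomp0r X Y Z (f : cell C Y Z) : f ∘ (0 : cell C X Y) = 0.
Proof. exact: linear0_ext (vcomp_linear_r f). Qed.

Lemma dagD X Y : {morph (@dag R C a b X Y) : f g / f + g}.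
Proof.
by move=> f g; have := dag_antilinear 1 f g; rewrite rmorph1 !scale1r.
Qed.

Lemma dag0 X Y : (0 : cell C X Y)^† = 0.
Proof. by apply: (addIr 0^†); rewrite -dagD !addr0 add0r. Qed.

Lemma dagZ X Y k (f : cell C X Y) : (k *: f)^† = k^* *: f^†.
Proof. by have := dag_antilinear k f 0; rewrite dag0 !addr0. Qed.

Lemma dagN X Y : {morph (@dag R C a b X Y) : f / - f}.
Proof. by move=> f; rewrite -scaleN1r dagZ rmorphN1 scaleN1r. Qed.

Lemma dagB X Y : {morph (@dag R C a b X Y) : f g / f - g}.
Proof. by move=> f g; rewrite dagD dagN. Qed.

Lemma conjCR (r : R) : (r%:C%C : R[i])^* = r%:C%C.
Proof. exact: conjc_real. Qed.

Lemma conjCi : ('i%C : R[i])^* = - 'i%C.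
Proof.
by rewrite -[LHS]/(conjc 'i%C); apply/eqP; rewrite eq_complex /= oppr0 !eqxx.
Qed.

Lemma dagZR X Y (r : R) (f : cell C X Y) : (r%:C%C *: f)^† = r%:C%C *: f^†.
Proof. by rewrite dagZ conjCR. Qed.

End Linear.

(** * Square roots in the endomorphism algebras of a C*-2-category *)

Section Norm.
Variables (R : realType) (C : dag2cat R) (hS : is_cstar C) (a b : obj C).
Implicit Types X Y Z : mor C a b.
Local Notation "`‖ f ‖" := (cnorm f) (at level 0, f at level 99).
Local Notation "r • f" := (r%:C%C *: f) (at level 40, left associativity).

Lemma cnorm_ge0 X Y (f : cell C X Y) : 0 <= `‖f‖.
Proof. exact: sqrtr_ge0. Qed.

Lemma normc_real (r : R) : Normc.normc r%:C%C = `|r|.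
Proof. by rewrite /= expr0n addr0 sqrtr_sqr. Qed.

Lemma cnormZR X Y (r : R) (f : cell C X Y) : `‖r • f‖ = `|r| * `‖f‖.
Proof. by rewrite cnormZ // normc_real. Qed.

Lemma cnorm0 X Y : `‖(0 : cell C X Y)‖ = 0.
Proof. by rewrite -(scale0r (0 : cell C X Y)) cnormZ // Normc.normc0 mul0r. Qed.

Lemma cnormN X Y (f : cell C X Y) : `‖- f‖ = `‖f‖.
Proof.
have -> : - f = (-1) • f by rewrite rmorphN1 scaleN1r.
by rewrite cnormZR normrN1 mul1r.
Qed.

Lemma cnormB X Y (f g : cell C X Y) : `‖f - g‖ <= `‖f‖ + `‖g‖.
Proof. by rewrite -(cnormN g) cnormD. Qed.

Lemma cnorm_dag_le X Y (f : cell C X Y) : `‖f‖ <= `‖f^†‖.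
Proof.
have := cnormM hS f^† f; rewrite cnorm_cstar // expr2.
have := cnorm_ge0 f; rewrite le_eqVlt => /orP[/eqP<- _|f0].
  exact: cnorm_ge0.
by rewrite ler_pM2r.
Qed.

Lemma cnorm_dag X Y (f : cell C X Y) : `‖f^†‖ = `‖f‖.
Proof. by apply/eqP; rewrite eq_le -{2}(dagK f) !cnorm_dag_le. Qed.

Lemma cnorm_sq X (f : cell C X X) : f^† = f -> `‖f ∘ f‖ = `‖f‖ ^+ 2.
Proof. by move=> fs; rewrite -cnorm_cstar // fs. Qed.

Lemma cnorm_id X : `‖id2 X‖ <= 1.
Proof.
have := cnorm_cstar hS (id2 X); rewrite dag1 vcomp1l; nra.
Qed.

Definition cvgs X Y (u : nat -> cell C X Y) (l : cell C X Y) :=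
  forall e : R, 0 < e -> exists N, forall n, (N <= n)%N -> `‖u n - l‖ < e.

Lemma cvgs_unique X Y (u : nat -> cell C X Y) l l' :
  cvgs u l -> cvgs u l' -> l = l'.
Proof.
move=> ul ul'; apply/eqP; rewrite -subr_eq0; apply/eqP/(cnorm_eq0 hS).
apply/eqP; rewrite eq_le cnorm_ge0 andbT leNgt; apply/negP => d0.
have d2 : 0 < `‖l - l'‖ / 2 by rewrite divr_gt0.
have [N hN] := ul _ d2; have [M hM] := ul' _ d2.
have := cnormB (u (maxn N M) - l') (u (maxn N M) - l).
rewrite opprB addrC addrA subrK.
have := hN _ (leq_maxl N M); have := hM _ (leq_maxr N M).
lra.
Qed.

Lemma cvgs_le X Y Z W (u : nat -> cell C X Y) l (w : nat -> cell C Z W) m k :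
  0 <= k -> cvgs u l -> (forall n, `‖w n - m‖ <= k * `‖u n - l‖) -> cvgs w m.
Proof.
move=> k0 ul h e e0.
have [|N hN] := ul (e / (k + 1)); first by rewrite divr_gt0 // ltr_wpDl.
exists N => n /hN; rewrite ltr_pdivlMr ?ltr_wpDl // => hn.
apply: le_lt_trans (h n) _; apply: le_lt_trans hn; rewrite mulrC ler_wpM2l //.
  exact: cnorm_ge0.
by rewrite lerDl.
Qed.

Lemma cvgs_ext X Y (u v : nat -> cell C X Y) l : u =1 v -> cvgs u l -> cvgs v l.
Proof. by move=> uv ul e /ul[N hN]; exists N => n /hN; rewrite uv. Qed.

Lemma cvgs_dag X Y (u : nat -> cell C X Y) l :
  cvgs u l -> cvgs (fun n => (u n)^†) l^†.
Proof.
move/cvgs_le; apply; first exact: ler01.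
by move=> n; rewrite -dagB cnorm_dag mul1r.
Qed.

Lemma cvgs_vcompl X Y Z (u : nat -> cell C X Y) l (g : cell C Y Z) :
  cvgs u l -> cvgs (fun n => g ∘ u n) (g ∘ l).
Proof.
by move/(cvgs_le (cnorm_ge0 g)); apply=> n; rewrite -vcompBr cnormM.
Qed.

Lemma cvgs_vcompr X Y Z (u : nat -> cell C X Y) l (g : cell C Z X) :
  cvgs u l -> cvgs (fun n => u n ∘ g) (l ∘ g).
Proof.
move/(cvgs_le (cnorm_ge0 g)); apply=> n.
by rewrite -vcompBl mulrC cnormM.
Qed.

Lemma cvgs_shift X Y (u : nat -> cell C X Y) l :
  cvgs u l -> cvgs (fun n => u n.+1) l.
Proof. by move=> ul e /ul[N hN]; exists N => n Nn; apply: hN; exact: leqW. Qed.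

Lemma cvgs_bound X Y (u : nat -> cell C X Y) l (k : R) :
  cvgs u l -> (forall n, `‖u n‖ <= k) -> `‖l‖ <= k.
Proof.
move=> ul uk; rewrite leNgt; apply/negP => kl.
have [|N /(_ _ (leqnn _)) hN] := ul (`‖l‖ - k); first by rewrite subr_gt0.
have := cnormB (u N) (u N - l); rewrite opprB addrC subrK.
have := uk N; lra.
Qed.

Lemma half_split X Y (f : cell C X Y) : 2^-1 • f + 2^-1 • f = f.
Proof.
have h : (2^-1 : R) + 2^-1 = 1 by lra.
by rewrite -scalerDl -rmorphD h rmorph1 scale1r.
Qed.

Section Sqrt.
Variables (X : mor C a b) (x : cell C X X).
Hypotheses (xs : x^† = x) (x1 : `‖x‖ < 1).

Fixpoint sqrt_iter n : cell C X X :=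
  if n is m.+1 then 2^-1 • (x + (sqrt_iter m ∘ sqrt_iter m)) else 0.

Lemma sqrt_iter_dag n : (sqrt_iter n)^† = sqrt_iter n.
Proof. by elim: n => [|n IH] /=; rewrite ?dag0 // dagZR dagD dag_vcomp IH xs. Qed.

Lemma sqrt_iter_comm y n : y ∘ x = x ∘ y -> y ∘ sqrt_iter n = sqrt_iter n ∘ y.
Proof.
move=> yx; elim: n => [|n IH] /=; first by rewrite vcomp0l vcomp0r.
by rewrite vcompZl vcompZr vcompDl vcompDr yx vcompA IH -vcompA IH vcompA.
Qed.

Lemma sqrt_iter_bound n : `‖sqrt_iter n‖ <= `‖x‖.
Proof.
have x0 := cnorm_ge0 x.
elim: n => [|n IH] /=; first by rewrite cnorm0.
rewrite cnormZR ger0_norm ?invr_ge0 //.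
have := cnormD hS x (sqrt_iter n ∘ sqrt_iter n).
have := cnormM hS (sqrt_iter n) (sqrt_iter n).
have := cnorm_ge0 (sqrt_iter n).
move: IH x1; nra.
Qed.

Lemma square_lip (y z : cell C X X) :
  `‖y‖ <= `‖x‖ -> `‖z‖ <= `‖x‖ ->
  `‖y ∘ y - (z ∘ z)‖ <= 2 * `‖x‖ * `‖y - z‖.
Proof.
move=> hy hz.
have -> : y ∘ y - (z ∘ z) = y ∘ (y - z) + ((y - z) ∘ z).
  by rewrite vcompBr vcompBl addrA subrK.
have := cnormD hS (y ∘ (y - z)) ((y - z) ∘ z).
have := cnormM hS y (y - z); have := cnormM hS (y - z) z.
have := cnorm_ge0 (y - z); move: hy hz.
nra.
Qed.

Lemma sqrt_iter_contract m n :
  `‖sqrt_iter (n + m) - sqrt_iter n‖ <= `‖x‖ ^+ n.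
Proof.
elim: n => [|n IH] /=.
  by rewrite expr0 subr0; apply: le_trans (sqrt_iter_bound _) (ltW x1).
rewrite -scalerBr cnormZR ger0_norm ?invr_ge0 // exprS.
rewrite opprD addrACA subrr add0r.
have := square_lip (sqrt_iter_bound (n + m)) (sqrt_iter_bound n).
have := cnorm_ge0 x; move: IH.
nra.
Qed.

Lemma sqrt_iter_cvg : exists z, cvgs sqrt_iter z.
Proof.
have x0 := cnorm_ge0 x.
apply: (cnorm_complete hS) => e e0.
have [N _ hN] : \forall N \near \oo, `‖x‖ ^+ N < e / 2.
  have := @cvg_expr R `‖x‖; rewrite ger0_norm // => /(_ x1) /cvgrPdist_lt.
  move=> /(_ (e / 2)); rewrite divr_gt0 // => /(_ isT).
  by apply: filterS => n; rewrite sub0r normrN ger0_norm ?exprn_ge0.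
exists N => m n Nm Nn.
have hm := sqrt_iter_contract (m - N) N.
have hn := sqrt_iter_contract (n - N) N.
rewrite subnKC // in hm; rewrite subnKC // in hn.
have := cnormB (sqrt_iter m - sqrt_iter N) (sqrt_iter n - sqrt_iter N).
rewrite opprB addrA subrK.
have := hN N (leqnn N); lra.
Qed.

(** The iteration z -> (x + z^2) / 2 is a contraction of the ball of radius |x|.
    Its fixed point z satisfies (1 - z)^2 = 1 - x, and inherits self-adjointness
    and commutation with y from the iterates. As |z| < 1, the root 1 - z may
    itself be given to this lemma. *)
Lemma sqrt_exists : exists s : cell C X X,
  [/\ s^† = s, s ∘ s = id2 X - x, `‖id2 X - s‖ < 1 &
      forall y, y ∘ x = x ∘ y -> y ∘ s = s ∘ y].
Proof.
have [z hz] := sqrt_iter_cvg.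
have zb := cvgs_bound hz sqrt_iter_bound.
have zs : z^† = z.
  apply: (cvgs_unique _ hz); apply: cvgs_ext (cvgs_dag hz) => n.
  exact: sqrt_iter_dag.
have zE : z = 2^-1 • (x + (z ∘ z)).
  apply: cvgs_unique (cvgs_shift hz) _.
  apply: (cvgs_le (cnorm_ge0 x) hz) => n /=.
  rewrite -scalerBr cnormZR ger0_norm ?invr_ge0 //.
  rewrite opprD addrACA subrr add0r.
  have := square_lip (sqrt_iter_bound n) zb; lra.
exists (id2 X - z); split.
- by rewrite dagB dag1 zs.
- have zz : z ∘ z = z + z - x by rewrite {3 4}zE half_split addrC addKr.
  by rewrite vcompBl vcomp1l vcompBr vcomp1r zz opprB addrC (addrAC (z + z))
    addrK addrC addrA subrK.
- by rewrite opprB addrC subrK; apply: le_lt_trans x1.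
- move=> y yx; rewrite vcompBl vcompBr vcomp1l vcomp1r; congr (_ - _).
  apply: cvgs_unique (cvgs_vcompl y hz) _.
  apply: cvgs_ext (cvgs_vcompr y hz) => n.
  by rewrite (sqrt_iter_comm _ yx).
Qed.

End Sqrt.

Lemma scale1R X Y (f : cell C X Y) : 1 • f = f.
Proof. by rewrite rmorph1 scale1r. Qed.

Lemma scaleRA X Y (r s : R) (f : cell C X Y) : r • (s • f) = (r * s) • f.
Proof. by rewrite scalerA -rmorphM. Qed.

(** With s = sqrt(1 - x^2) the element x + i s is unitary, so its imaginary part
    s has norm at most 1. *)
Lemma cnorm_sub_square1 X (x : cell C X X) :
  x^† = x -> `‖x‖ < 1 -> `‖id2 X - (x ∘ x)‖ <= 1.
Proof.
move=> xs x1; have x0 := cnorm_ge0 x.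
have [|| s [ss s2 _ sc]] := @sqrt_exists X (x ∘ x).
- by rewrite dag_vcomp xs.
- by rewrite cnorm_sq // expr_lt1.
have sx : x ∘ s = s ∘ x by apply: sc; rewrite vcompA.
pose U := x + 'i%C *: s.
have Ud : U^† = x - 'i%C *: s by rewrite dagD dagZ xs ss conjCi scaleNr.
have U1 : U^† ∘ U = id2 X.
  rewrite Ud vcompBl !vcompDr vcompZl !vcompZr vcompZl sx.
  rewrite scalerA -expr2 sqr_i scaleN1r opprD addrA addrK opprK s2 addrC.
  by rewrite subrK.
have Un : `‖U‖ <= 1.
  have := cnorm_cstar hS U; rewrite U1; have := cnorm_id X.
  have := cnorm_ge0 U; nra.
have sn : `‖s‖ <= 1.
  have := cnormB U U^†; rewrite cnorm_dag Ud opprB addrC addrA subrK.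
  rewrite -scalerDr cnormZ // (_ : Normc.normc _ = 1); last first.
    by rewrite /= expr0n expr1n add0r sqrtr1.
  have -> : s + s = 2 • s by rewrite rmorph_nat scaler_nat mulr2n.
  rewrite cnormZR ger0_norm //; move: Un; lra.
rewrite -s2 cnorm_sq // -(expr1n _ 2) lerXn2r ?nnegrE //; exact: cnorm_ge0.
Qed.

(** Positivity of the square of a self-adjoint element, expressed by the norm. *)
Lemma cnorm_sub_square X (x : cell C X X) (t : R) :
  x^† = x -> `‖x‖ ^+ 2 < t -> `‖t • id2 X - (x ∘ x)‖ <= t.
Proof.
move=> xs xt; have t0 : 0 < t by apply: le_lt_trans xt; rewrite sqr_ge0.
have q0 : 0 < Num.sqrt t by rewrite sqrtr_gt0.
have tE : t = Num.sqrt t * Num.sqrt t by rewrite -expr2 sqr_sqrtr ?ltW.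
move: (Num.sqrt t) q0 tE xt => q q0 -> xt.
have xq : `‖x‖ < q by rewrite -(ltr_sqr (cnorm_ge0 x) (ltW q0)) expr2.
have -> : x ∘ x = (q * q) • ((q^-1 • x) ∘ (q^-1 • x)).
  by rewrite vcompZl vcompZr !scaleRA mulfK ?gt_eqF // divff ?gt_eqF // scale1R.
have qq : 0 <= q * q by rewrite mulr_ge0 // ltW.
rewrite -scalerBr cnormZR (ger0_norm qq) ler_piMr //.
apply: cnorm_sub_square1; first by rewrite dagZR xs.
by rewrite cnormZR normfV (gtr0_norm q0) mulrC ltr_pdivrMr // mul1r.
Qed.

Lemma double_cell X Y (f : cell C X Y) : f + f = 2 • f.
Proof. by rewrite rmorph_nat scaler_nat mulr2n. Qed.

Lemma inverse_dag X (h g : cell C X X) :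
  h^† = h -> g ∘ h = id2 X -> h ∘ g = id2 X -> g^† = g.
Proof.
move=> hs gh hg; rewrite -(vcomp1r g^†) -hg vcompA -{1}hs -dag_vcomp hg dag1.
exact: vcomp1l.
Qed.

(** As h^2 is invertible, h^2 - d is for small d still the square of a
    self-adjoint element, namely of h sqrt(1 - d h^-2). Positivity of that
    square keeps a multiple of h^2 at distance less than 1 from the identity,
    within reach of [sqrt_exists]. *)
Lemma square_invertible X (h : cell C X X) :
  h^† = h -> invertible h ->
  exists2 c : R, 0 < c & `‖id2 X - c • (h ∘ h)‖ < 1.
Proof.
move=> hs [g [gh hg]]; have gs := inverse_dag hs gh hg.
have g0 := cnorm_ge0 g.
pose d := (`‖g‖ ^+ 2 + 1)^-1.
have d0 : 0 < d by rewrite invr_gt0 ltr_wpDl // sqr_ge0.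
(* r is sqrt(1 - d h^-2), and d was chosen so that |d h^-2| < 1 *)
have [|| r [rs r2 _ rc]] := @sqrt_exists X (d • (g ∘ g)).
- by rewrite dagZR dag_vcomp gs.
- rewrite cnormZR gtr0_norm // cnorm_sq // mulrC ltr_pdivrMr ?mul1r ?ltrDl //.
  by rewrite ltr_wpDl // sqr_ge0.
have hr : h ∘ r = r ∘ h.
  by apply: rc; rewrite vcompZr vcompZl vcompA hg -vcompA gh vcomp1l vcomp1r.
pose y := h ∘ r.
have ys : y^† = y by rewrite dag_vcomp hs rs -hr.
have yy : y ∘ y = h ∘ h - d • id2 X.
  rewrite /y {2}hr -vcompA (vcompA r) r2 vcompBl vcomp1l vcompBr; congr (_ - _).
  by rewrite vcompZl vcompZr -(vcompA g) gh vcomp1r hg.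
pose t := `‖y‖ ^+ 2 + 1.
have t0 : 0 < t by rewrite ltr_wpDl // sqr_ge0.
have td : 0 < t + d by rewrite addr_gt0.
have := cnorm_sub_square ys (_ : _ < t); rewrite ltrDl => /(_ ltr01).
rewrite yy opprB addrA -scalerDl -rmorphD => tb.
exists (t + d)^-1; first by rewrite invr_gt0.
have -> : id2 X = (t + d)^-1 • ((t + d) • id2 X).
  by rewrite scaleRA mulVf ?gt_eqF // scale1R.
rewrite -scalerBr cnormZR normfV (gtr0_norm td) mulrC ltr_pdivrMr // mul1r.
by apply: le_lt_trans tb _; rewrite ltrDl.
Qed.

(** Write w^† w = g^† g with g an endomorphism. Then g g^† = - q for an idempotent
    q, and A = g + g^†, B = i (g - g^†) are self-adjoint with
    A^2 + B^2 = 2 (g^† g + g g^†) = - 2 (1 + q). Positivity of A^2 and of B^2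
    forbids this unless q = 0, that is g = 0. *)
Lemma no_negative X Y (w : cell C X Y) : w^† ∘ w = - id2 X -> id2 X = 0.
Proof.
move=> ww; have [g gg] := cstar_pos hS w; rewrite {}ww in gg.
pose q := - (g ∘ g^†).
have qq : q ∘ q = q.
  rewrite /q vcompNl vcompNr opprK -vcompA (vcompA g^†) -gg.
  by rewrite vcompNl vcompNr vcomp1l.
pose A := g + g^†.
pose B := 'i%C *: (g - g^†).
have As : A^† = A by rewrite dagD dagK addrC.
have Bs : B^† = B by rewrite dagZ dagB dagK conjCi scaleNr -scalerN opprB.
have AB : (A ∘ A) + (B ∘ B) = - 2 • (id2 X + q).
  rewrite /B vcompZl vcompZr scalerA -expr2 sqr_i scaleN1r.
  rewrite vcompBl !vcompBr vcompDl !vcompDr.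
  have zmodE (V : zmodType) (p u v z : V) :
      p + u + (v + z) - (p - u - (v - z)) = u + v + (u + v).
    rewrite opprB (addrC (v - z)) addrACA opprB (addrC p) (addrACA u).
    by rewrite (addrACA v) !subrr !addr0 addrACA.
  rewrite zmodE -gg -[g ∘ g^†]opprK -/q double_cell -opprD.
  by rewrite (addrC q) scalerN rmorphN scaleNr.
pose t := `‖A‖ ^+ 2 + `‖B‖ ^+ 2 + 1.
have [A0 B0] : 0 <= `‖A‖ ^+ 2 /\ 0 <= `‖B‖ ^+ 2 by rewrite !sqr_ge0.
have tA := cnorm_sub_square As (_ : _ < t).
have tB := cnorm_sub_square Bs (_ : _ < t).
have qb : `‖(2 * t + 4) • q‖ <= 2 * t * `‖q‖.
  have -> : (2 * t + 4) • q = q ∘ ((t • id2 X - (A ∘ A)) + (t • id2 X - (B ∘ B))).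
    rewrite addrACA -opprD AB vcompDr vcompNr.
    rewrite double_cell !vcompZr vcompDr !vcomp1r qq double_cell !scaleRA -scaleNr.
    rewrite -scalerDl.
    by rewrite -rmorphN -rmorphD; congr (_%:C%C *: _); ring.
  apply: le_trans (cnormM hS _ _) _; rewrite mulrC ler_wpM2r ?cnorm_ge0 //.
  apply: le_trans (cnormD hS _ _) _.
  have := tA; have := tB; rewrite /t; lra.
have q0 : q = 0.
  apply: (cnorm_eq0 hS); move: qb; rewrite cnormZR ger0_norm.
    have := cnorm_ge0 q; rewrite /t; nra.
  rewrite /t; lra.
have g0 : g^† = 0.
  apply: (cnorm_eq0 hS); apply/eqP; rewrite -sqrf_eq0 -cnorm_cstar // dagK.
  by rewrite -cnormN -/q q0 cnorm0.
by rewrite -(opprK (id2 X)) gg g0 vcomp0l oppr0.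
Qed.

Lemma right_inverse_comm X (t r y : cell C X X) :
  r ∘ t = id2 X -> t ∘ r = id2 X -> y ∘ t = t ∘ y -> y ∘ r = r ∘ y.
Proof.
move=> rt tr yt; rewrite -(vcomp1l (y ∘ r)) -rt -!vcompA (vcompA t) -yt.
by rewrite -vcompA tr vcomp1r.
Qed.

(** Only the square of h = f^† f is known to be positive at this stage. Its
    fourth root t stands for the square root of |h|, so that u = f t^-1 has
    u^† u = t^-1 h t^-1, the sign of h. *)
Lemma symmetric_polar X Y (f : cell C X Y) : invertible f ->
  exists2 u : cell C X Y, invertible u &
    (u^† ∘ u) ∘ (u^† ∘ u) = id2 X.
Proof.
case=> f1 [f1f ff1].
have gE : forall g : cell C X Y, invertible g -> invertible (g^† ∘ g).
  move=> g [g1 [g1g gg1]]; exists (g1 ∘ g1^†); split.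
    by rewrite -!vcompA (vcompA g1^†) -dag_vcomp gg1 dag1 vcomp1l.
  by rewrite -!vcompA (vcompA g) gg1 vcomp1l -dag_vcomp g1g dag1.
have fi : invertible f by exists f1.
have [|c c0] := square_invertible (_ : (f^† ∘ f)^† = _) (gE _ fi).
  by rewrite dag_vcomp dagK.
(* rescaling f by a fourth root of c brings (f^† f)^2 close to the identity *)
pose k := Num.sqrt (Num.sqrt c).
have k0 : 0 < k by rewrite !sqrtr_gt0.
have kE : k * k * (k * k) = c.
  by rewrite -!expr2 sqr_sqrtr ?sqrtr_ge0 // sqr_sqrtr // ltW.
have kfi : invertible (k • f).
  exists (k^-1 • f1).
  by rewrite !vcompZl !vcompZr !scaleRA mulVf ?divff ?gt_eqF // !scale1R f1f.
have -> : c • (f^† ∘ f ∘ (f^† ∘ f)) =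
    (k • f)^† ∘ (k • f) ∘ ((k • f)^† ∘ (k • f)).
  by rewrite dagZR !vcompZl !vcompZr !vcompZl !scaleRA -kE !mulrA.
move: (k • f) kfi => {}f {k k0 kE c c0 f1 f1f ff1} fi.
have [f1 [f1f ff1]] := fi; have [g [gh hg]] := gE _ fi.
have hs : (f^† ∘ f)^† = f^† ∘ f by rewrite dag_vcomp dagK.
move hE: (f^† ∘ f) hs gh hg => h hs gh hg h1.
have [|| s [ss]] := @sqrt_exists X (id2 X - (h ∘ h)) => //.
  by rewrite dagB dag1 dag_vcomp hs.
rewrite opprB addrC subrK => s2 s1 sc.
have [|| t [ts]] := @sqrt_exists X (id2 X - s) => //.
  by rewrite dagB dag1 ss.
rewrite opprB addrC subrK => t2 _ tc.
have ht : h ∘ t = t ∘ h.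
  apply: tc; rewrite vcompBl vcompBr vcomp1l vcomp1r; congr (_ - _).
  by apply: sc; rewrite vcompBl vcompBr vcomp1l vcomp1r vcompA.
have gt : g ∘ t = t ∘ g by rewrite (right_inverse_comm gh hg (esym ht)).
(* t^4 = h^2 and g = h^-1, so this is t^-1 *)
pose r := t ∘ t ∘ t ∘ g ∘ g.
have tr : t ∘ r = id2 X.
  by rewrite /r !vcompA t2 -(vcompA s) t2 s2 -(vcompA h) hg vcomp1r hg.
have rt : r ∘ t = id2 X.
  rewrite -[RHS]tr /r -!vcompA gt (vcompA g) gt -!vcompA.
  by rewrite (vcompA t g) -gt.
have rs : r^† = r := inverse_dag ts rt tr.
have hr : h ∘ r = r ∘ h := right_inverse_comm rt tr ht.
clearbody r; exists (f ∘ r).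
  exists (t ∘ f1); split.
    by rewrite -vcompA (vcompA f1) f1f vcomp1l.
  by rewrite -vcompA (vcompA r) rt vcomp1l.
have -> : (f ∘ r)^† ∘ (f ∘ r) = r ∘ r ∘ h.
  by rewrite dag_vcomp rs -vcompA (vcompA f^†) hE hr vcompA.
rewrite -!vcompA (vcompA h r) hr -(vcompA r h) (vcompA h r) hr.
rewrite -(vcompA r) -s2 -t2.
by rewrite -!vcompA !(vc1 rt).
Qed.

(** The symmetry e = u^† u is the identity: splitting the projection (1 - e) / 2
    as w w^† gives (u w)^† (u w) = -1. *)
Lemma unitary_of_invertible (hC : cauchy_complete C) X Y (f : cell C X Y) :
  invertible f -> exists u : cell C X Y, is_unitary u.
Proof.
move=> /symmetric_polar[u [v [vu uv]] ee].
have es : (u^† ∘ u)^† = u^† ∘ u by rewrite dag_vcomp dagK.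
move eE: (u^† ∘ u) es ee => e es ee.
pose p := 2^-1 • (id2 X - e).
have ps : p^† = p by rewrite dagZR dagB dag1 es.
have ep : e ∘ p = - p.
  by rewrite vcompZr vcompBr vcomp1r ee -scalerN opprB.
have pp : p ∘ p = p.
  rewrite {1}/p vcompZl vcompBl vcomp1l ep opprK double_cell scaleRA mulVf.
    by rewrite scale1R.
  by rewrite pnatr_eq0.
have [W [w [ww pE]]] := projections_split hC (conj pp ps).
have ew : e ∘ w = - w.
  by rewrite -(vcomp1r w) -ww (vcompA w) -pE vcompA ep vcompNl.
have /no_negative W0 : (u ∘ w)^† ∘ (u ∘ w) = - id2 W.
  by rewrite dag_vcomp -vcompA (vcompA u^†) eE ew vcompNr ww.
have p0 : p = 0 by rewrite pE -(vcomp1r w) W0 vcomp0r vcomp0l.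
have e1 : e = id2 X.
  apply/eqP; rewrite eq_sym -subr_eq0; move/eqP: p0; rewrite scaler_eq0.
  case/orP=> // /eqP /(congr1 (@Normc.normc _)).
  rewrite normc_real Normc.normc0 => /eqP.
  by rewrite normr_eq0 invr_eq0 pnatr_eq0.
exists u; split; first by rewrite eE.
suff -> : u^† = v by [].
by rewrite -(vcomp1r u^†) -uv vcompA eE e1 vcomp1l.
Qed.

End Norm.

(** * Adjoint equivalences *)

Section Whisker.
Variables (R : realType) (D : dag2cat R) (a b : obj D).
Variables (X : mor D a b) (Y : mor D b a) (eps : cell D (Y ⊠ X) (unit1 b)).
Hypothesis epsi : invertible eps.

(** Whiskering with X and then with Y is whiskering with Y X, which eps turns
    into whiskering with a unit. *)
Lemma whisker_faithful (c : obj D) (Z Z' : mor D b c) (f g : cell D Z Z') :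
  X ◁ f = X ◁ g -> f = g.
Proof.
case: epsi => e [_ ee] /(congr1 (fun h => Y ◁ h)) /= fg.
have ez : (eps ▷ Z) ∘ (e ▷ Z) = id2 _ := rwV Z ee.
apply: unit_faithl; rewrite -[LHS]vcomp1r -[RHS]vcomp1r -ez !vcompA !slide'.
rewrite -(slide eps f) -(slide eps g); do 2 congr (_ ∘ _).
by apply: (lcancel (assocVl Y X Z')); rewrite !anR fg.
Qed.

(** The preimage of g is Y g transported along Y X Z = Z; that it is a preimage
    can be tested after whiskering with Y. *)
Lemma whisker_full (c : obj D)
    (Z Z' : mor D b c) (g : cell D (X ⊠ Z) (X ⊠ Z')) :
  (forall (W W' : mor D a c) (h k : cell D W W'), Y ◁ h = Y ◁ k -> h = k) ->
  exists f : cell D Z Z', X ◁ f = g.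
Proof.
move=> Yf; case: epsi => e [ee' ee].
pose th (W : mor D b c) := lunit W ∘ (eps ▷ W) ∘ (assoc Y X W)^†.
pose th' (W : mor D b c) := assoc Y X W ∘ (e ▷ W) ∘ (lunit W)^†.
have thK W : th' W ∘ th W = id2 _.
  rewrite /th /th' -!vcompA (vc1 (lunitVl _)) (vcompA (e ▷ W)).
  by rewrite (rwV _ ee') vcomp1l assocVr.
have thN (f : cell D Z Z') : th Z' ∘ (Y ◁ (X ◁ f)) = f ∘ th Z.
  rewrite /th -!vcompA danR (vc (slide _ _)) -(slide' eps f) -!vcompA.
  by rewrite (vcompA (lunit Z')) lunit_nat -!vcompA.
(* th and th' are mutually inverse: the isomorphism of Y X Z with Z *)
clearbody th th'; exists (th Z' ∘ (Y ◁ g) ∘ th' Z); apply: Yf.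
rewrite -[LHS]vcomp1l -(thK Z') -[LHS]vcompA thN.
by rewrite -!vcompA thK vcomp1r vcompA thK vcomp1l.
Qed.

End Whisker.

Section Adjoint.
Variables (R : realType) (D : dag2cat R).

(** Both sides become e ⊡ e after composition with the monomorphism e. *)
Lemma unitary_mul_sym (a : obj D) (T : mor D a a) (e : cell D T (unit1 a)) :
  is_unitary e -> lunit T ∘ (e ▷ T) = runit T ∘ (T ◁ e).
Proof.
case=> e1 _; apply: (lcancel e1).
by rewrite !vcompA -lunit_nat -runit_nat -!vcompA slide' slide lunit_runit.
Qed.

(** Whiskering with X is fully faithful, so the first identity X eps = e X
    defines eps, and eps is unitary because whiskering commutes with the dagger.
    The second identity holds after whiskering with X: with associators and
    unitors suppressed, X eps Y = e X Y = X Y e by [unitary_mul_sym]. *)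
Lemma adjoint_counit (a b : obj D) (X : mor D a b) (Y : mor D b a)
    (e : cell D (X ⊠ Y) (unit1 a)) (eps0 : cell D (Y ⊠ X) (unit1 b)) :
  is_unitary e -> invertible eps0 ->
  exists eps : cell D (Y ⊠ X) (unit1 b),
  [/\ is_unitary eps,
      runit X ∘ (X ◁ eps) ∘ assoc X Y X = lunit X ∘ (e ▷ X) &
      lunit Y ∘ (eps ▷ Y) = runit Y ∘ (Y ◁ e) ∘ assoc Y X Y].
Proof.
move=> eU eps0i; have [e1 e2] := eU.
have ei : invertible e by exists e^†.
have Xf := whisker_faithful eps0i; have Yf := whisker_faithful ei.
pose g := (runit X)^† ∘ lunit X ∘ (e ▷ X) ∘ (assoc X Y X)^†.
have [eps epsE] := whisker_full eps0i g (Yf _).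
have A : runit X ∘ (X ◁ eps) ∘ assoc X Y X = lunit X ∘ (e ▷ X).
  rewrite epsE /g -!vcompA assocVl vcomp1r.
  by rewrite (vc1 (runitVr _)).
exists eps; split=> //.
  have E1 : (e^† ▷ X) ∘ (e ▷ X) = id2 _ := rwV X e1.
  have E2 : (e ▷ X) ∘ (e^† ▷ X) = id2 _ := rwV X e2.
  have epsD : X ◁ eps^† = g^† by rewrite -epsE dag_hcomp dag1.
  have gD : g^† = assoc X Y X ∘ ((e^† ▷ X) ∘ ((lunit X)^† ∘ runit X)).
    by rewrite !dag_vcomp dag_hcomp !dagK dag1.
  split; apply: Xf; rewrite -lwM epsD epsE hcomp1 gD /g -!vcompA.
    rewrite (vc1 (runitVr _)) (vc1 (lunitVl _)) (vc1 E1).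
    by rewrite assocVr.
  rewrite (vc1 (assocVl _ _ _)) (vc1 E2) (vc1 (lunitVr _)).
  by rewrite runitVl.
(* the second identity, compared on ((X Y) X) Y *)
apply: Xf; apply: (rcancel (assocVr X (Y ⊠ X) Y)).
have aY : (assoc X Y X ▷ Y) ∘ (assoc X Y X ▷ Y)^† = id2 _.
  by rewrite dag_hcomp dag1; apply: rwV; exact: assocVr.
apply: (rcancel aY).
have -> : (X ◁ (lunit Y ∘ (eps ▷ Y))) ∘ assoc X (Y ⊠ X) Y =
    (runit X ∘ (X ◁ eps)) ▷ Y.
  by rewrite -lwM -vcompA -anM vcompA triangle rwM.
rewrite rwM A -rwM -kelly_l -vcompA anL vcompA.
rewrite unitary_mul_sym // kelly_r -!vcompA.
rewrite -!lwM -!vcompA (vcompA (X ◁ assoc Y X Y)) pentagon.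
by rewrite (vcompA (assoc X Y _)) anR -!vcompA.
Qed.

End Adjoint.

Section Bending.
Variables (R : realType) (D : dag2cat R) (b c : obj D).
Variables (X : mor D b c) (V : mor D c b) (e : cell D (V ⊠ X) (unit1 c)).

(** The multiplication of X V contracts the inner V X. Read with V it is a right
    action on V, read with X a left action on X. *)
Lemma bend_mul :
  (X ◁ (lunit V ∘ (e ▷ V) ∘ (assoc V X V)^†)) ∘ assoc X V (X ⊠ V) =
  ((runit X ∘ (X ◁ e) ∘ assoc X V X) ▷ V) ∘ (assoc (X ⊠ V) X V)^†.
Proof.
apply: (rcancel (assocVr (X ⊠ V) X V)).
rewrite -(vcompA _ _^†) assocVl vcomp1r -[LHS]vcompA -pentagon -!lwM -!vcompA.
rewrite (vcompA (X ◁ _^†)) lwV ?assocVl // vcomp1l.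
by rewrite (vc (esym (anM _ _ _))) vcompA vcompA triangle !rwM vcompA.
Qed.

End Bending.

(** * Splittings from Morita equivalences *)

Section SplitData.
Variables (R : realType) (C : dag2cat R) (b c : obj C) (Q : qdata b).
Variables (Y : mor C b c) (V : mor C c b).
Variables (l : cell C (qcar Q ⊠ Y) Y) (r : cell C (V ⊠ qcar Q) V).
Variables (e : cell C (V ⊠ Y) (unit1 c)) (phi : cell C (Y ⊠ V) (qcar Q)).
Hypotheses (l1 : l ∘ (quni Q ▷ Y) = lunit Y) (r1 : r ∘ (V ◁ quni Q) = runit V).
Hypotheses (e_sep : e ∘ e^† = id2 (unit1 c)) (phiU : is_unitary phi).
Hypothesis phi_l :
  phi ∘ (l ▷ V) = qmul Q ∘ (qcar Q ◁ phi) ∘ assoc (qcar Q) Y V.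
Hypothesis bal_l : l ∘ (phi ▷ Y) = runit Y ∘ (Y ◁ e) ∘ assoc Y V Y.
Hypothesis bal_r : r ∘ (V ◁ phi) ∘ assoc V Y V = lunit V ∘ (e ▷ V).

(** Balancing turns the contraction into the action l, and the coevaluation
    phi^† i into the unit of Q: what remains is the unit law. *)
Lemma split_zigzag_l : runit Y ∘ (Y ◁ e) ∘ assoc Y V Y ∘
  ((phi^† ∘ quni Q) ▷ Y) ∘ (lunit Y)^† = id2 Y.
Proof.
have [_ p2] := phiU.
rewrite -bal_l -!vcompA (vcompA (phi ▷ Y)) rwM (vcompA phi) p2 vcomp1l.
by rewrite vcompA l1 lunitVr.
Qed.

Lemma split_zigzag_r : lunit V ∘ (e ▷ V) ∘ (assoc V Y V)^† ∘
  (V ◁ (phi^† ∘ quni Q)) ∘ (runit V)^† = id2 V.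
Proof.
have [_ p2] := phiU.
rewrite -bal_r -!vcompA (vc1 (assocVr _ _ _)) (vcompA (V ◁ phi)) lwM.
by rewrite (vcompA phi) p2 vcomp1l vcompA r1 runitVr.
Qed.

(** The contraction Y e V is l V after phi by [bend_mul] and balancing, and phi is
    a map of left Q-modules. *)
Lemma split_mul :
  phi ∘ ((Y ◁ (lunit V ∘ (e ▷ V) ∘ (assoc V Y V)^†)) ∘ assoc Y V (Y ⊠ V)) =
  qmul Q ∘ (phi ⊡ phi).
Proof.
rewrite bend_mul -bal_l -rwM -!vcompA -danL (vc phi_l) -!vcompA.
by rewrite (vc1 (assocVr _ _ _)) slide'.
Qed.

Lemma splits_of_balanced : qsys_splits Q.
Proof.
have [p1 p2] := phiU.
exists c, Y, (Dual split_zigzag_l split_zigzag_r); split; first exact: e_sep.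
exists phi^†; split=> //; first by split; rewrite dagK.
apply: (lcancel p1); rewrite /= vcompA p2 vcomp1l [RHS]vcompA split_mul.
by rewrite -vcompA interchange p2 hcomp1 vcomp1r.
Qed.

End SplitData.

Section Trivial.
Variables (R : realType) (C : dag2cat R).

(** The unit of a trivial Q-system is an identity, so unitality determines the
    action. *)
Lemma triv_lact (a b : obj C) (Q : qdata b) (X : bimod (triv_qdata a) Q) :
  lact X = lunit X.
Proof. by have := lmod1 (lactP X); rewrite hcomp1 vcomp1r. Qed.

Lemma triv_ract (a b : obj C) (P : qdata a) (X : bimod P (triv_qdata b)) :
  ract X = runit X.
Proof. by have := rmod1 (ractP X); rewrite hcomp1 vcomp1r. Qed.

Lemma triv_mid (hC : cauchy_complete C) (a b c : obj C) (P : qdata a)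
    (Q : qdata c) (X : bimod P (triv_qdata b)) (Y : bimod (triv_qdata b) Q) :
  (relu hC X Y)^† ∘ relu hC X Y = id2 (X ⊠ Y).
Proof.
by rewrite relu_proj triv_lact triv_ract triangle rwV // runitVr.
Qed.

Lemma triv_lmap (a b : obj C) (Q : qdata b) (X Y : bimod (triv_qdata a) Q)
  (f : cell C X Y) : lmap (lact X) (lact Y) f.
Proof. by rewrite /lmap !triv_lact /= lunit_nat. Qed.

Lemma triv_rmap (a b : obj C) (P : qdata a) (X Y : bimod P (triv_qdata b))
  (f : cell C X Y) : rmap (ract X) (ract Y) f.
Proof. by rewrite /rmap !triv_ract /= runit_nat. Qed.

End Trivial.

Section Forward.
Variables (R : realType) (C : dag2cat R) (hC : cauchy_complete C).
Variables (b c : obj C) (Q : qdata b) (hQ : is_qsys Q).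
Local Notation D := (qsys2cat hC).

Section Split.
Variables (X : bimod (triv_qdata c) Q) (Y : bimod Q (triv_qdata c)).
Variables (e : bicell (reltens hC X Y) (regular (triv_qsys c))).
Variables (eps : bicell (reltens hC Y X) (regular hQ)).
Hypotheses (eU : is_unitary (bval e)) (epsU : is_unitary (bval eps)).
Hypothesis A : relrunit0 hC hQ X ∘ bval (relhcomp hC (bicell_id X) eps) ∘
    relassoc0 hC X Y X =
  rellunit0 hC (triv_qsys c) X ∘ bval (relhcomp hC e (bicell_id X)).
Hypothesis B : rellunit0 hC hQ Y ∘ bval (relhcomp hC eps (bicell_id Y)) =
  relrunit0 hC (triv_qsys c) Y ∘ bval (relhcomp hC (bicell_id Y) e) ∘
    relassoc0 hC Y X Y.

(** The structure maps of QSys(C) are given by those of C after precomposition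
    with the coisometry from X Y X to (X (x)_Q Y) (x) X, which is epi. *)
Lemma unfold_bal_r :
  ract X ∘ (X ◁ (bval eps ∘ relu hC Y X)) ∘ assoc X Y X =
  lunit X ∘ ((bval e ∘ relu hC X Y) ▷ X).
Proof.
have E1 := relhcompu hC (bicell_id X) eps.
have E2 := relhcompu hC e (bicell_id X).
have E3 := relassoc0U hC X Y X.
have E4 := relrunitu hC hQ X; have E5 := rellunitu hC (triv_qsys c) X.
have := congr1 (fun h => h ∘ relU hC X Y X) A.
rewrite -[X in X = _ -> _]vcompA E3 /relU /relV.
move: (bval (relhcomp hC (bicell_id X) eps)) E1 => F E1.
move: (bval (relhcomp hC e (bicell_id X))) E2 => G E2.
move: (relrunit0 hC hQ X) (rellunit0 hC (triv_qsys c) X) E4 E5 => r l E4 E5.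
rewrite /= in E1 E2.
rewrite -!vcompA (vc E1) (vc E2) -!vcompA (vc E4) (vc E5) triv_lact.
by rewrite (vcompA (X ◁ bval eps)) lwM rwM.
Qed.

Lemma unfold_bal_l :
  lact Y ∘ ((bval eps ∘ relu hC Y X) ▷ Y) =
  runit Y ∘ (Y ◁ (bval e ∘ relu hC X Y)) ∘ assoc Y X Y.
Proof.
have E1 := relhcompu hC (bicell_id Y) e.
have E2 := relhcompu hC eps (bicell_id Y).
have E3 := relassoc0U hC Y X Y.
have E4 := rellunitu hC hQ Y; have E5 := relrunitu hC (triv_qsys c) Y.
have := congr1 (fun h => h ∘ relU hC Y X Y) B.
rewrite -[X in _ = X -> _]vcompA E3 /relU /relV.
move: (bval (relhcomp hC (bicell_id Y) e)) E1 => F E1.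
move: (bval (relhcomp hC eps (bicell_id Y))) E2 => G E2.
move: (rellunit0 hC hQ Y) (relrunit0 hC (triv_qsys c) Y) E4 E5 => l r E4 E5.
rewrite /= in E1 E2.
rewrite -!vcompA (vc E1) (vc E2) -!vcompA (vc E4) (vc E5) triv_ract.
by rewrite (vcompA (Y ◁ bval e)) lwM rwM.
Qed.

Lemma splits_of_adjoint : qsys_splits Q.
Proof.
have [e1 e2] := eU; have [p1 p2] := epsU.
apply: (@splits_of_balanced R C b c Q Y X (lact Y) (ract X)
  (bval e ∘ relu hC X Y) (bval eps ∘ relu hC Y X)).
- exact: lmod1 (lactP Y).
- exact: rmod1 (ractP X).
- by rewrite dag_vcomp -!vcompA (vcompA (relu hC X Y)) reluV vcomp1l.
- split; rewrite dag_vcomp -!vcompA.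
    by rewrite (vc1 p1) triv_mid.
  by rewrite (vcompA (relu hC Y X)) reluV vcomp1l.
- have [_ _ h] := rellactP hC Y X.
  have := lmap_comp (bicell_l eps) h; rewrite /lmap /lact_tens /= => <-.
  by rewrite -!vcompA assocVl vcomp1r.
- exact: unfold_bal_l.
- exact: unfold_bal_r.
Qed.

End Split.

Lemma bicell_unitary (P P' : obj D) (X Y : mor D P P') (f : cell D X Y) :
  is_unitary f -> is_unitary (bval f).
Proof.
by case=> /(congr1 (fun h => bval h)) h1 /(congr1 (fun h => bval h)) h2.
Qed.

(** The unit of the equivalence is a 2-morphism between 1_c-1_c bimodules, where
    bimodularity is automatic. So it may be replaced by a unitary found in C. *)
Lemma splits_of_equivalent : is_cstar C ->
  equivalent (fobj (iota hC) c) (QSys hQ : obj D) -> qsys_splits Q.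
Proof.
move=> hS [X [Y [eta [eps0 [etai eps0i]]]]].
have bi : invertible (bval eta).
  case: etai => g [/(congr1 (fun h => bval h)) h1 /(congr1 (fun h => bval h)) h2].
  by exists (bval g).
have [u [u1 u2]] := unitary_of_invertible hS hC bi.
pose e : bicell (reltens hC X Y) (regular (triv_qsys c)) :=
  mk_bicell (triv_lmap u^†) (triv_rmap u^†).
have eU : is_unitary (e : cell D (X ⊠ Y) (unit1 _)).
  by split; apply: val_inj; rewrite /= dagK.
have [eps [epsU A B]] := adjoint_counit eU eps0i.
apply: (@splits_of_adjoint X Y e eps).
- exact: bicell_unitary eU.
- exact: bicell_unitary epsU.
- exact: (congr1 (fun h => bval h) A).
- exact: (congr1 (fun h => bval h) B).
Qed.

End Forward.

(** * Morita equivalences from splittings *)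

Section Transport.
Variables (R : realType) (C : dag2cat R) (a b : obj C) (P P' : qdata a).
Variables (u : cell C (qcar P) (qcar P')) (X : mor C a b).
Variables (l : cell C (qcar P' ⊠ X) X).
Hypotheses (uU : is_unitary u) (um : u ∘ qmul P = qmul P' ∘ (u ⊡ u)).
Hypotheses (ui : u ∘ quni P = quni P') (hl : is_lmod l).

(** The Frobenius law is where unitarity of u enters, through
    m_P = u^† m_P' (u ⊡ u). *)
Lemma lmod_transport : is_lmod (l ∘ (u ▷ X)).
Proof.
have [u1 u2] := uU; have [hA h1 hF _ hS] := hl.
have um' : qmul P = u^† ∘ qmul P' ∘ (u ⊡ u).
  by rewrite -vcompA -um vcompA u1 vcomp1l.
apply: mk_lmod.
- rewrite -lwM -!vcompA (vc (slide _ _)) -(slide' u l) -!vcompA.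
  rewrite (vcompA (u ▷ _)) slide -assoc_nat.
  by rewrite !vcompA hA -vcompA rwM -um -rwM !vcompA.
- by rewrite -vcompA rwM ui.
- rewrite um' dag_vcomp dag_hcomp dag1 -!rwM -!vcompA.
  rewrite (vcompA _ (assoc _ _ _)^†) -dan -!vcompA interchange vcomp1r.
  rewrite (vcompA (u ▷ X)) rwM u2 hcomp1 vcomp1l -(slide' u l^†).
  by rewrite (vcompA (l^†)) -hF -!vcompA.
- by rewrite dag_vcomp dag_hcomp dag1 -!vcompA (vcompA (u ▷ X)) rwM u2 hcomp1
    vcomp1l.
Qed.

End Transport.

Lemma runit_dag_nat (R : realType) (C : dag2cat R) (a b : obj C)
    (X Y : mor C a b) (f : cell C X Y) :
  (f ▷ unit1 b) ∘ (runit X)^† = (runit Y)^† ∘ f.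
Proof.
apply: dag_inj; rewrite !dag_vcomp !dagK dag_hcomp dag1.
by rewrite runit_nat.
Qed.

Lemma lunit_dag_nat (R : realType) (C : dag2cat R) (a b : obj C)
    (X Y : mor C a b) (f : cell C X Y) :
  (unit1 a ◁ f) ∘ (lunit X)^† = (lunit Y)^† ∘ f.
Proof.
apply: dag_inj; rewrite !dag_vcomp !dagK dag_hcomp dag1.
by rewrite lunit_nat.
Qed.

Lemma kelly_l_dag (R : realType) (C : dag2cat R) (a b c : obj C)
    (X : mor C a b) (Y : mor C b c) :
  assoc (unit1 a) X Y ∘ ((lunit X)^† ▷ Y) = (lunit (X ⊠ Y))^†.
Proof.
apply: dag_inj; rewrite dag_vcomp dag_hcomp dag1 !dagK -kelly_l.
by rewrite -vcompA assocVr vcomp1r.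
Qed.

Section DualModule.
Variables (R : realType) (C : dag2cat R) (b c : obj C) (X : mor C b c).
Variables (D : dual X) (sep : unitarily_separable D).
Local Notation V := (dcar D).

Definition ev_act : cell C ((X ⊠ V) ⊠ X) X := runit X ∘ (X ◁ ev D) ∘ assoc X V X.

Lemma dual_qmulE :
  qmul (dual_qdata D) = (ev_act ▷ V) ∘ (assoc (X ⊠ V) X V)^†.
Proof. exact: bend_mul. Qed.

(** The maps f and ev act at disjoint places. *)
Lemma ev_act_nat (T : mor C b c) (f : cell C T X) :
  ev_act ∘ ((f ▷ V) ▷ X) = f ∘ runit T ∘ (T ◁ ev D) ∘ assoc T V X.
Proof.
rewrite /ev_act -!vcompA anL (vc (slide' _ _)) -(slide f (ev D)) -!vcompA.
by rewrite (vcompA (runit X)) runit_nat -!vcompA.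
Qed.

(** Here the pentagon enters: all associators on the right come before the
    contraction, so that the module axioms reduce to [ev_act_nat]. *)
Lemma ev_actE :
  ((X ⊠ V) ◁ ev_act) ∘ assoc (X ⊠ V) (X ⊠ V) X =
  runit ((X ⊠ V) ⊠ X) ∘ (((X ⊠ V) ⊠ X) ◁ ev D) ∘ assoc ((X ⊠ V) ⊠ X) V X ∘
    ((assoc (X ⊠ V) X V)^† ▷ X).
Proof.
rewrite /ev_act -!lwM -!vcompA pent2 -!vcompA kelly_r -!vcompA.
by rewrite (vcompA (assoc _ X (unit1 c))) anR -!vcompA.
Qed.

(** Associativity and the Frobenius law hold because the contractions in them take
    place at disjoint positions; the unit law is a zig-zag equation and
    separability is ev ev^† = 1. *)
Lemma ev_lmod : is_lmod (P := dual_qdata D) ev_act.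
Proof.
apply: mk_lmod.
- by rewrite dual_qmulE -rwM -vcompA ev_actE !vcompA ev_act_nat -!vcompA.
- have /(congr1 (fun h => h ∘ lunit X)) := zigzag_l D.
  by rewrite -!vcompA lunitVl vcomp1r vcomp1l.
- have E := congr1 (fun h => h^†) ev_actE.
  rewrite !dag_vcomp !dag_hcomp !dagK !dag1 in E.
  rewrite dual_qmulE -rwM -!vcompA /= E.
  rewrite (vc1 (rwV X (assocVl _ _ _))) (vc (esym (danL _ _ _))) -!vcompA.
  rewrite (vc (slide _ _)) -(slide' ev_act) -!vcompA.
  by rewrite runit_dag_nat {2}/ev_act !dag_vcomp dag_hcomp dag1 -!vcompA.
- rewrite /ev_act !dag_vcomp dag_hcomp dag1 -!vcompA (vc1 (assocVr _ _ _)).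
  by rewrite (vcompA (X ◁ _)) lwM sep hcomp1 vcomp1l runitVr.
Qed.

Lemma zigzag_op : lunit V ∘ (ev D ▷ V) ∘ (assoc V X V)^† ∘ (V ◁ coev D) ∘
  (runit V)^† = id2 V.
Proof. exact: zigzag_r. Qed.

Lemma zigzag_op' : runit X ∘ (X ◁ ev D) ∘ (assoc X V X)^†^† ∘ (coev D ▷ X) ∘
  (lunit X)^† = id2 X.
Proof. by rewrite dagK; exact: zigzag_l. Qed.

(** Reversing 1-morphisms exchanges X and its dual, so that [ev_lmod] also yields
    the right module structure of the dual. *)
Definition dual_op : @dual R (op C) b c V :=
  @Dual R (op C) b c V X (ev D) (coev D) zigzag_op zigzag_op'.

Lemma dual_opE : qmul (dual_qdata dual_op) = qmul (dual_qdata D).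
Proof. by rewrite dual_qmulE /ev_act /= dagK. Qed.

End DualModule.

Section Splitting.
Variables (R : realType) (C : dag2cat R) (b c : obj C) (Q : qdata b).
Variables (X : mor C b c) (D : dual X) (sep : unitarily_separable D).
Variables (u : cell C (qcar Q) (X ⊠ dcar D)).
Hypotheses (uU : is_unitary u).
Hypothesis um : u ∘ qmul Q = qmul (dual_qdata D) ∘ (u ⊡ u).
Hypothesis ui : u ∘ quni Q = coev D.
Local Notation V := (dcar D).

Definition split_lact : cell C (qcar Q ⊠ X) X := ev_act D ∘ (u ▷ X).

Definition ev_act_r : cell C (V ⊠ (X ⊠ V)) V :=
  lunit V ∘ (ev D ▷ V) ∘ (assoc V X V)^†.

Definition split_ract : cell C (V ⊠ qcar Q) V := ev_act_r ∘ (V ◁ u).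

Lemma split_lmod : is_lmod split_lact.
Proof. exact: (lmod_transport (P' := dual_qdata D) uU um ui (ev_lmod sep)). Qed.

Lemma split_rmod : is_rmod split_ract.
Proof.
apply: op_rmod.
have hl := @ev_lmod R (op C) b c V (dual_op D) sep.
have um' : u ∘ qmul Q = qmul (dual_qdata (dual_op D)) ∘ (u ⊡ u).
  by rewrite dual_opE.
exact: (@lmod_transport R (op C) b c
  (@QData R (op C) b (qcar Q) (qmul Q) (quni Q)) (dual_qdata (dual_op D))
  u V (ev_act (dual_op D)) uU um' ui hl).
Qed.

Definition split_bimod : bimod Q (triv_qdata c).
Proof.
apply: (Bimod split_lmod (triv_rmod X)).
by rewrite /= runit_nat kelly_r vcompA.
Defined.

Definition split_dual_bimod : bimod (triv_qdata c) Q.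
Proof.
apply: (Bimod (triv_lmod V) split_rmod).
by rewrite /= lunit_nat -kelly_l vcompA.
Defined.

(** The right action of Q on V, daggered, creates a pair next to V and the left
    action on X contracts the other one; the pentagon and the unitors bring this
    to the form ev^† ev. *)
Lemma split_relproj : relproj split_ract split_lact = (ev D)^† ∘ ev D.
Proof.
have [u1 u2] := uU.
rewrite /relproj /split_lact /split_ract dag_vcomp dag_hcomp dag1 -lwM -rwM.
rewrite -!vcompA (vc (esym (anM _ _ _))) -!vcompA (vcompA (_ ▷ X) (_ ▷ X)).
rewrite rwM lwM u2 !hcomp1 vcomp1l.
rewrite /ev_act /ev_act_r !dag_vcomp dag_hcomp dag1 dagK -!lwM -!rwM -!vcompA.
rewrite (vcompA (V ◁ assoc X V X)) (vc (pentagon V X V X)) -!vcompA.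
rewrite (vc (anL _ _ _)) -!vcompA kelly_l_dag (vcompA (V ◁ (X ◁ ev D))) -anR.
rewrite -!vcompA (vcompA (V ◁ runit X)) -kelly_r (vc (slide' _ _)).
rewrite -(slide (ev D)^† (ev D)) -!vcompA lunit_dag_nat (vcompA (runit _)).
by rewrite runit_nat -!vcompA -lunit_runit (vc1 (lunitVr _)).
Qed.

Variables (hC : cauchy_complete C) (hQ : is_qsys Q).
Local Notation XQ := split_bimod.
Local Notation VQ := split_dual_bimod.

Lemma split_eps_l :
  lmap (lact (reltens hC XQ VQ)) (qmul Q) (u^† ∘ (relu hC XQ VQ)^†).
Proof.
have [u1 u2] := uU; have [_ h _] := rellactP hC XQ VQ; apply: lmap_comp h.
apply: (lcancel u1); rewrite [RHS]vcompA um vcompA u2 vcomp1l.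
rewrite -[RHS]vcompA interchange u2 vcomp1r dual_qmulE -vcompA -hcomp1.
by rewrite dan vcompA /lact_tens /= /split_lact -rwM -!vcompA.
Qed.

Lemma split_eps_r :
  rmap (ract (reltens hC XQ VQ)) (qmul Q) (u^† ∘ (relu hC XQ VQ)^†).
Proof.
have [u1 u2] := uU; have [_ h _] := relractP hC XQ VQ; apply: rmap_comp h.
apply: (lcancel u1); rewrite [RHS]vcompA um vcompA u2 vcomp1l.
rewrite -[RHS]vcompA interchange u2 vcomp1r /= -vcompA anR.
by rewrite /ract_tens /= /split_ract -lwM -!vcompA /ev_act_r -!vcompA.
Qed.

Definition split_eta : bicell (regular (triv_qsys c)) (reltens hC VQ XQ) :=
  @mk_bicell R C c c _ _ (regular (triv_qsys c)) (reltens hC VQ XQ)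
    (relu hC VQ XQ ∘ (ev D)^†) (triv_lmap _) (triv_rmap _).

Definition split_eps : bicell (reltens hC XQ VQ) (regular hQ) :=
  @mk_bicell R C b b _ _ (reltens hC XQ VQ) (regular hQ) _
    split_eps_l split_eps_r.

Lemma split_eta_unitary : is_unitary (bval split_eta).
Proof.
have sepE : ev D ∘ (ev D)^† = id2 _ := sep.
have pE : (relu hC VQ XQ)^† ∘ relu hC VQ XQ = (ev D)^† ∘ ev D.
  by rewrite reluE; exact: split_relproj.
rewrite /=; split; rewrite dag_vcomp dagK -!vcompA.
  by rewrite (vc pE) -!vcompA sepE vcomp1r.
rewrite (vcompA (ev D)^†) -pE -!vcompA.
by rewrite (vcompA (relu hC VQ XQ)) reluV vcomp1l.
Qed.

Lemma split_eps_unitary : is_unitary (bval split_eps).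
Proof.
have [u1 u2] := uU.
rewrite /=; split; rewrite dag_vcomp !dagK -!vcompA.
  by rewrite (vc1 u2) reluV.
by rewrite (vc1 (triv_mid hC XQ VQ)) u1.
Qed.

Lemma invertible_bicell (a d : obj C) (P : qdata a) (S : qdata d)
    (hP : is_qsys P) (hS : is_qsys S)
    (Y Z : mor (qsys2cat hC) (QSys hP) (QSys hS))
    (f : cell (qsys2cat hC) Y Z) :
  is_unitary (bval f) -> invertible f.
Proof. by case=> f1 f2; exists f^†; split; apply: val_inj. Qed.

Lemma equivalent_of_split :
  equivalent (fobj (iota hC) c) (QSys hQ : obj (qsys2cat hC)).
Proof.
exists VQ, XQ, split_eta, split_eps; split; apply: invertible_bicell.
  exact: split_eta_unitary.
exact: split_eps_unitary.
Qed.

End Splitting.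

(** * Q-system completeness *)

Section Main.
Variables (R : realType) (C : dag2cat R) (hC : cauchy_complete C).

(** On hom categories the inclusion is an equivalence by [triv_lmap] and
    [triv_rmap]; objects are reached by [equivalent_of_split]. *)
Lemma complete_of_splits : every_qsys_splits C -> qsys_complete hC.
Proof.
move=> hs; split.
- move=> [b Q hQ]; have [c [X [D [sep [u [uU um ui]]]]]] := hs b Q hQ.
  by exists c; exact: (@equivalent_of_split R C b c Q X D sep u uU um ui hC hQ).
- move=> a b Y; exists (bcar Y).
  exists (@mk_bicell R C a b _ _ (triv_bimod (bcar Y)) Y (id2 (bcar Y))
     (triv_lmap _) (triv_rmap _)).
  by split; apply: val_inj; rewrite /= dag1 vcomp1l.
- move=> a b X Y; 
  exists (fun f : bicell (triv_bimod X) (triv_bimod Y) => bval f) => f //.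
  exact: val_inj.
Qed.

Lemma splits_of_complete :
  is_cstar C -> qsys_complete hC -> every_qsys_splits C.
Proof.
move=> hS [hobj _ _] b Q hQ; have [c] := hobj (QSys hQ).
exact: splits_of_equivalent.
Qed.

End Main.

Theorem theorem3p36 (R : realType) (C : dag2cat R) (hC : cauchy_complete C) :
  (is_cstar C -> (qsys_complete hC <-> every_qsys_splits C)) /\
  (is_wstar C -> (qsys_complete hC <-> every_qsys_splits C)).
Proof.
have main : is_cstar C -> (qsys_complete hC <-> every_qsys_splits C).
  move=> hS; split; first exact: splits_of_complete.
  exact: complete_of_splits.
by split=> // -[hS _]; exact: main.
Qed.
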